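(* Fix a small enough positive constant $\gamma>0$ and assume that $k>\Omega(1/\gamma)$ (i.e. $k\ge C/\gamma$ for a suitable absolute constant $C$). Let $G=(V,E,w)$ be an edge-weighted graph on $n$ vertices, let $OPT$ be the weight of a minimum $k$-cut of $G$, let $M:=OPT/k$, and for $A\subseteq V$ let $\bar w(A):=w(\partial_G A)/(M/2)$. Then $G$ has at most: (1) $O(2^k n)$ subsets $A\subseteq V$ with $\bar w(A)\le 3-\gamma$; (2) $O(2^k n^2)$ subsets $A\subseteq V$ with $\bar w(A)\le 10/3-\gamma$; (3) $O(2^k n^{3-1/4})$ subsets $A\subseteq V$ with $\bar w(A)\le 4-\gamma$; (4) $O(2^k n^{4-1/4})$ subsets $A\subseteq V$ with $\bar w(A)\le 14/3-\gamma$.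
   Context: Edge weights are nonnegative. For $A\subseteq V$, $\partial_G A$ is the set of edges with exactly one endpoint in $A$, and $w(F)=\sum_{e\in F}w(e)$. A $k$-cut is a partition of $V$ into $k$ nonempty parts; its weight is the total weight of edges joining different parts; a minimum $k$-cut has minimum such weight. *)

(* Defs.v *)
From HB Require Import structures.
From mathcomp Require Import all_boot all_order all_algebra.
From mathcomp Require Import reals exp.

Set Implicit Arguments.
Unset Strict Implicit.
Unset Printing Implicit Defensive.

Import Order.TTheory GRing.Theory Num.Theory.
Local Open Scope ring_scope.

(* An edge is the two-element set of its endpoints; the values of [weight]
   outside [edges] are irrelevant. *)
Record wgraph (R : realType) (V : finType) := WGraph {
  edges : {set {set V}};
  weight : {set V} -> R;
  edges_card2 : forall e, e \in edges -> #|e| = 2%N;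
  weight_ge0 : forall e, e \in edges -> 0 <= weight e }.

Section Cuts.
Context {R : realType} {V : finType}.
Implicit Types (G : wgraph R V) (A : {set V}) (F P Q : {set {set V}}).

Definition boundary G A : {set {set V}} :=
  [set e in edges G | #|e :&: A| == 1%N].

Definition total_weight G F : R := \sum_(e in F) weight G e.

(* The parts are nonempty because [partition] requires [set0 \notin P]. *)
Definition is_kcut (k : nat) P : bool :=
  partition P [set: V] && (#|P| == k).

Definition crossing_edges G P : {set {set V}} :=
  [set e in edges G | [exists x in e, exists y in e, pblock P x != pblock P y]].

Definition kcut_weight G P : R := total_weight G (crossing_edges G P).

Definition is_min_kcut G (k : nat) P : Prop :=
  is_kcut k P /\ forall Q, is_kcut k Q -> kcut_weight G P <= kcut_weight G Q.

(* As a relation rather than a function: there is no k-cut when k > #|V|. *)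
Definition is_opt G (k : nat) (OPT : R) : Prop :=
  exists2 P, is_min_kcut G k P & OPT = kcut_weight G P.

Definition wbar G (M : R) A : R := total_weight G (boundary G A) / (M / 2).

Definition cuts_upto G (M t : R) : {set {set V}} :=
  [set A : {set V} | wbar G M A <= t].

End Cuts.

(* Main.v *)
(* The cuts of weight at most t behave like a set system in which few sets
   generate few atoms.  Choose greedily cuts that create new parts at an average
   price below (2 - gamma / 3) per part, in units of M / 2.  The process stops
   with fewer than k parts, since k parts would cost at least OPT, and afterwards
   no one, two or three further cuts create many new parts at once.  For the four
   thresholds this says that, inside one part, any two cuts generate at most 3
   atoms, or any three generate at most 5, 6 or 7 atoms; in the last case a cut
   may also split two parts.

   It remains to bound a family on m points any three members of which generate
   at most a atoms.  Deleting a point x, the members A with A and x |: A both in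
   the family satisfy the same condition with a - 1, so the bound gains one power
   of m with each a, from O(1) for a = 3.  For a = 6 this gives only m ^ 3.  To
   reach m ^ (3 - 1/4), put s = n ^ (1/4).  A member C with s <= #|C| <= m - s
   splits the family into its traces on C and on the complement, up to O(m ^ 2)
   members.  If there is no such C, then up to complement all members have size
   at most s; delete the members containing a pair of points that lies in O(s ^ 3)
   members only, and show that nothing of size at least 2 is left: otherwise
   inclusion-maximal members D1, D2, D3 with the patterns 110, 101, 011 present
   and with the largest union generate seven atoms. *)

Require Import Defs.
From HB Require Import structures.
From mathcomp Require Import all_boot all_order all_algebra.
From mathcomp Require Import reals exp.
From mathcomp Require Import zify ring lra.

Set Implicit Arguments.
Unset Strict Implicit.
Unset Printing Implicit Defensive.

Import Order.TTheory GRing.Theory Num.Theory.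
Local Open Scope ring_scope.

(** * Atoms of two and three sets on a ground set *)

Section Patterns.
Local Open Scope nat_scope.
Variable V : finType.
Implicit Types (W P Q A B C D : {set V}) (F : {set {set V}}).

Definition pat2 A B x := (x \in A, x \in B).
Definition pat3 A B C x := (x \in A, x \in B, x \in C).

Definition atoms2 W A B := #|pat2 A B @: W|.
Definition atoms3 W A B C := #|pat3 A B C @: W|.

Definition cell W A B C a b c := (a, b, c) \in pat3 A B C @: W.

Lemma cellP W A B C a b c :
  reflect (exists2 x, x \in W & [/\ (x \in A) = a, (x \in B) = b & (x \in C) = c])
          (cell W A B C a b c).
Proof.
apply: (iffP imsetP) => [[x xW [-> -> ->]]|[x xW [<- <- <-]]]; by exists x.
Qed.

Lemma card_bool3 (S : {set bool * bool * bool}) :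
  #|S| = ((true, true, true) \in S) + ((true, true, false) \in S)
       + ((true, false, true) \in S) + ((true, false, false) \in S)
       + ((false, true, true) \in S) + ((false, true, false) \in S)
       + ((false, false, true) \in S) + ((false, false, false) \in S).
Proof.
have -> : #|S| = \sum_a \sum_b \sum_c ((a, b, c) \in S).
  rewrite pair_bigA /= pair_bigA /= -sum1_card big_mkcond /=.
  by apply: eq_bigr => -[[a b] c] _ /=; case: ifP.
by rewrite !big_bool /= !addnA.
Qed.

Lemma card_bool2 (S : {set bool * bool}) :
  #|S| = ((true, true) \in S) + ((true, false) \in S)
       + ((false, true) \in S) + ((false, false) \in S).
Proof.
have -> : #|S| = \sum_a \sum_b ((a, b) \in S).
  rewrite pair_bigA /= -sum1_card big_mkcond /=.
  by apply: eq_bigr => -[a b] _ /=; case: ifP.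
by rewrite !big_bool /= !addnA.
Qed.

Lemma atoms3E W A B C :
  atoms3 W A B C =
    cell W A B C true true true + cell W A B C true true false
  + cell W A B C true false true + cell W A B C true false false
  + cell W A B C false true true + cell W A B C false true false
  + cell W A B C false false true + cell W A B C false false false.
Proof. exact: card_bool3. Qed.

Lemma pat2_12 W A B C a b :
  ((a, b) \in pat2 A B @: W) = cell W A B C a b true || cell W A B C a b false.
Proof.
apply/imsetP/orP => [[x xW [-> ->]]|[] /cellP[x xW [<- <- _]]]; try by exists x.
case: (boolP (x \in C)) => xC; [left|right]; apply/cellP; exists x => //;
  by rewrite (negbTE xC).
Qed.

Lemma pat2_13 W A B C a b :
  ((a, b) \in pat2 A C @: W) = cell W A B C a true b || cell W A B C a false b.
Proof.
apply/imsetP/orP => [[x xW [-> ->]]|[] /cellP[x xW [<- _ <-]]]; try by exists x.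
case: (boolP (x \in B)) => xC; [left|right]; apply/cellP; exists x => //;
  by rewrite (negbTE xC).
Qed.

Lemma pat2_23 W A B C a b :
  ((a, b) \in pat2 B C @: W) = cell W A B C true a b || cell W A B C false a b.
Proof.
apply/imsetP/orP => [[x xW [-> ->]]|[] /cellP[x xW [_ <- <-]]]; try by exists x.
case: (boolP (x \in A)) => xC; [left|right]; apply/cellP; exists x => //;
  by rewrite (negbTE xC).
Qed.

Lemma atoms2E W A B :
  atoms2 W A B = ((true, true) \in pat2 A B @: W) + ((true, false) \in pat2 A B @: W)
   + ((false, true) \in pat2 A B @: W) + ((false, false) \in pat2 A B @: W).
Proof. exact: card_bool2. Qed.

(** A pair of equations works as one rewriting rule: it expresses the atom count of two of the sets
    through the eight cells of all three, so that [cell_cases] meets only eight booleans. *)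
Definition atoms2_12 W A B C := (atoms2E W A B, pat2_12 W A B C).
Definition atoms2_13 W A B C := (atoms2E W A C, pat2_13 W A B C).
Definition atoms2_23 W A B C := (atoms2E W B C, pat2_23 W A B C).

Lemma pat2P W A B a b :
  reflect (exists2 x, x \in W & (x \in A) = a /\ (x \in B) = b)
          ((a, b) \in pat2 A B @: W).
Proof.
by apply: (iffP imsetP) => [[x xW [-> ->]]|[x xW [<- <-]]]; exists x.
Qed.

Lemma cell_swap12 W A B C a b c : cell W B A C b a c = cell W A B C a b c.
Proof. by apply/cellP/cellP => -[x xW []]; exists x. Qed.

Lemma cell_swap23 W A B C a b c : cell W A C B a c b = cell W A B C a b c.
Proof. by apply/cellP/cellP => -[x xW []]; exists x. Qed.

Lemma cell_mono P W A B C A' B' C' a b c :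
  P \subset W -> {in P, A =i A'} -> {in P, B =i B'} -> {in P, C =i C'} ->
  cell P A B C a b c -> cell W A' B' C' a b c.
Proof.
move=> /subsetP PW eA eB eC /cellP[x xP [<- <- <-]]; apply/cellP; exists x.
  exact: PW.
by rewrite eA ?eB ?eC.
Qed.

Lemma atoms3_mono P W A B C A' B' C' :
  P \subset W -> {in P, A =i A'} -> {in P, B =i B'} -> {in P, C =i C'} ->
  atoms3 P A B C <= atoms3 W A' B' C'.
Proof.
move=> PW eA eB eC; apply: subset_leq_card; apply/subsetP => -[[a b] c].
exact: cell_mono.
Qed.

Lemma atoms2_mono P W A B A' B' :
  P \subset W -> {in P, A =i A'} -> {in P, B =i B'} ->
  atoms2 P A B <= atoms2 W A' B'.
Proof.
move=> /subsetP PW eA eB; apply: subset_leq_card; apply/subsetP => -[a b].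
case/pat2P=> x xP [<- <-]; apply/pat2P; exists x; first exact: PW.
by rewrite eA ?eB.
Qed.

Lemma atoms3_ext W A B C A' B' C' :
  {in W, A =i A'} -> {in W, B =i B'} -> {in W, C =i C'} ->
  atoms3 W A B C = atoms3 W A' B' C'.
Proof.
by move=> eA eB eC; apply/eqP; rewrite eqn_leq !atoms3_mono // => x xW;
  rewrite ?eA ?eB ?eC.
Qed.

Lemma atoms2_ext W A B A' B' :
  {in W, A =i A'} -> {in W, B =i B'} -> atoms2 W A B = atoms2 W A' B'.
Proof.
by move=> eA eB; apply/eqP; rewrite eqn_leq !atoms2_mono // => x xW;
  rewrite ?eA ?eB.
Qed.

End Patterns.

(* A statement about the atoms of three sets depends only on which of the eight
   cells are nonempty, so it can be checked by computation. *)
Definition all_bool (f : bool -> bool) := f true && f false.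

Lemma all_boolP f : all_bool f -> forall b, f b.
Proof. by case/andP=> ? ? []. Qed.

Lemma all_bool8P (f : bool -> bool -> bool -> bool -> bool -> bool -> bool -> bool -> bool) :
  all_bool (fun a => all_bool (fun b => all_bool (fun c => all_bool (fun d =>
  all_bool (fun e => all_bool (fun g => all_bool (fun h => all_bool (f a b c d e g h)))))))) ->
  forall a b c d e g h i, f a b c d e g h i.
Proof.
by move=> /all_boolP H a b c d e g h i; move: (H a) =>
  /all_boolP/(_ b)/all_boolP/(_ c)/all_boolP/(_ d)/all_boolP/(_ e)/all_boolP/(_ g)
  /all_boolP/(_ h)/all_boolP/(_ i).
Qed.

(** The hypotheses are gathered into one boolean implication, because [all_bool8P] needs a boolean
    function of the cells. *)
Ltac boolify :=
  lazymatch goal with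
  | |- is_true _ -> _ => let H := fresh in intro H; boolify; revert H; apply/implyP
  | |- _ => idtac
  end.

Ltac cell_cases W A B C :=
  boolify;
  move: (cell W A B C true true true) (cell W A B C true true false)
        (cell W A B C true false true) (cell W A B C true false false)
        (cell W A B C false true true) (cell W A B C false true false)
        (cell W A B C false false true) (cell W A B C false false false);
  apply: all_bool8P; vm_compute; exact: erefl.

(** * Families whose triples generate few atoms: polynomial bounds *)

Section TripleBounds.
Local Open Scope nat_scope.
Variable V : finType.
Implicit Types (W P Q A B C D : {set V}) (F : {set {set V}}).

Definition triple_le W F a := forall A B C,
  A \in F -> B \in F -> C \in F -> atoms3 W A B C <= a.

Definition flexible F P x A := forall b, exists2 D, D \in F &
  (x \in D) = b /\ {in P, A =i D}.

(* When all eight lifts of A, B, C are available at x, one of them makes the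
   pattern of x a new one. *)
Lemma flexible_triple W F P x a A B C :
  triple_le W F a.+1 -> a.+1 < 8 -> P \subset W -> x \in W ->
  flexible F P x A -> flexible F P x B -> flexible F P x C ->
  atoms3 P A B C <= a.
Proof.
move=> tF a8 PW xW fA fB fC; rewrite leqNgt; apply/negP => aP.
have [p pP] : exists p, (p \notin pat3 A B C @: P) || (atoms3 P A B C == 8).
  case: (set_0Vmem (~: (pat3 A B C @: P))) => [e|[p]]; last first.
    by rewrite inE => pP; exists p; rewrite pP.
  exists (true, true, true); apply/orP; right.
  have := cardsC (pat3 A B C @: P); rewrite e cards0 addn0 -/(atoms3 P A B C) => ->.
  by rewrite !card_prod !card_bool.
case: p pP => [[b1 b2] b3] pP.
have [A' A'F [xA eA]] := fA b1; have [B' B'F [xB eB]] := fB b2.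
have [C' C'F [xC eC]] := fC b3.
have := tF _ _ _ A'F B'F C'F.
have sub : pat3 A B C @: P \subset pat3 A' B' C' @: W.
  by apply/subsetP=> -[[a1 b4] c]; apply: cell_mono.
case/orP: pP => [pP|/eqP e8]; last first.
  by have := atoms3_mono PW eA eB eC; rewrite e8 => h1 h2;
    move: (leq_trans h1 h2); rewrite leqNgt a8.
have : (b1, b2, b3) |: pat3 A B C @: P \subset pat3 A' B' C' @: W.
  rewrite subUset sub sub1set andbT; apply/imsetP; exists x => //.
  by rewrite /pat3 xA xB xC.
move/subset_leq_card; rewrite cardsU1 pP /= -/(atoms3 P A B C) -/(atoms3 W A' B' C').
by rewrite add1n => h1 h2; move: (leq_trans h1 h2); rewrite ltnS leqNgt aP.
Qed.

Definition drop_pt x F := [set A :\ x | A in F].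
Definition link x F := [set A in F | (x \notin A) && (x |: A \in F)].

(** Deleting [x] identifies [A] with [x |: A], so a set of [drop_pt x F] arises twice exactly when
    it lies in [link x F]. This is inclusion-exclusion for the members without [x] and the shrunken
    members with [x]. *)
Lemma card_drop_link x F : #|F| = #|drop_pt x F| + #|link x F|.
Proof.
pose F0 := [set A in F | x \notin A]; pose F1 := [set A in F | x \in A].
pose F1' := [set A :\ x | A in F1].
have cF1 : #|F1'| = #|F1|.
  apply: card_in_imset => A B; rewrite !inE => /andP[_ xA] /andP[_ xB] e.
  by rewrite -(setD1K xA) e setD1K.
have -> : drop_pt x F = F0 :|: F1'.
  apply/setP=> A; rewrite inE; apply/imsetP/orP => [[B BF ->]|].
    case: (boolP (x \in B)) => xB; [right|left].
      by apply/imsetP; exists B; rewrite // inE BF xB.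
    rewrite inE; have -> : B :\ x = B by apply/setDidPl; rewrite disjoint_sym disjoints1.
    by rewrite BF xB.
  case=> [|/imsetP[B]].
    rewrite inE => /andP[AF xA]; exists A => //.
    by apply/esym/setDidPl; rewrite disjoint_sym disjoints1.
  by rewrite inE => /andP[BF _] ->; exists B.
have -> : link x F = F0 :&: F1'.
  apply/setP=> A; rewrite !inE; apply/and3P/andP => [[AF xA xAF]|[/andP[AF xA]]].
    split; first by rewrite AF xA.
    by apply/imsetP; exists (x |: A); rewrite ?inE ?xAF ?eqxx // setU1K.
  case/imsetP=> B; rewrite inE => /andP[BF xB] e; split=> //.
  by rewrite e setD1K.
rewrite cardsUI cF1 -cardsUI.
have -> : F0 :&: F1 = set0.
  by apply/setP=> A; rewrite !inE; case: (x \in A); rewrite ?andbF.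
rewrite cards0 addn0; congr #|pred_of_set _|; apply/setP=> A; rewrite !inE.
by case: (x \in A); rewrite ?andbF ?andbT ?orbF ?orbT.
Qed.

Lemma sub_drop_pt W F x : F \subset powerset W -> drop_pt x F \subset powerset (W :\ x).
Proof.
move=> /subsetP FW; apply/subsetP=> _ /imsetP[A AF ->]; rewrite powersetE.
by apply: setSD; rewrite -powersetE FW.
Qed.

Lemma sub_link W F x : F \subset powerset W -> link x F \subset powerset (W :\ x).
Proof.
move=> /subsetP FW; apply/subsetP=> A; rewrite inE => /and3P[AF xA _].
by rewrite powersetE subsetD1 xA -powersetE FW.
Qed.

Lemma triple_drop_pt W F x a : triple_le W F a -> triple_le (W :\ x) (drop_pt x F) a.
Proof.
move=> tF _ _ _ /imsetP[A AF ->] /imsetP[B BF ->] /imsetP[C CF ->].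
apply: leq_trans (tF _ _ _ AF BF CF); apply: atoms3_mono; first exact: subD1set.
all: by move=> y; rewrite !inE => /andP[-> _].
Qed.

(** Both lifts of a link member at [x] belong to [F], so the link is flexible at [x] and one atom is
    lost. *)
Lemma triple_link W F x a :
  triple_le W F a.+1 -> a.+1 < 8 -> x \in W -> triple_le (W :\ x) (link x F) a.
Proof.
move=> tF a8 xW A B C Al Bl Cl.
have fl D : D \in link x F -> flexible F (W :\ x) x D.
  rewrite inE => /and3P[DF xD xDF] [].
    exists (x |: D); rewrite ?setU11 //; split=> // y.
    by rewrite !inE => /andP[/negbTE ->].
  by exists D; rewrite // (negbTE xD).
by apply: (flexible_triple tF a8 (subD1set _ _) xW); apply: fl.
Qed.

Lemma triple_sub W P F (G : {set {set V}}) a : G \subset F -> P \subset W ->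
  triple_le W F a -> triple_le P G a.
Proof.
move=> /subsetP GF PW tF A B C /GF AF /GF BF /GF CF.
exact: leq_trans (atoms3_mono PW _ _ _) (tF _ _ _ AF BF CF).
Qed.

(* Choose A, B generating as many atoms as possible: no member splits them. *)
Lemma card_triple3 W F : F \subset powerset W -> triple_le W F 3 -> #|F| <= 16.
Proof.
move=> /subsetP FW tF; have [->|[A0 A0F]] := set_0Vmem F; first by rewrite cards0.
have AA0 : (A0, A0) \in setX F F by rewrite inE A0F.
case: (@arg_maxnP _ _ [in setX F F] (fun p => atoms2 W p.1 p.2) AA0) => -[A B] /=.
rewrite inE /= => /andP[AF BF] maxAB.
(* Three distinct patterns are already told apart by two of the three sets, so by maximality [C]
   adds no atom. *)
have cst C : C \in F -> atoms3 W A B C <= atoms2 W A B.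
  move=> CF; have := tF _ _ _ AF BF CF.
  have := maxAB (A, C); have := maxAB (B, C); rewrite !inE AF BF CF /=.
  move=> /(_ isT) + /(_ isT); rewrite /geq /=.
  rewrite !(atoms2_12 W A B C) !(atoms2_13 W A B C) !(atoms2_23 W A B C) atoms3E.
  cell_cases W A B C.
have cstx C a b : C \in F -> ~~ (cell W A B C a b true && cell W A B C a b false).
  move=> /cst; rewrite !(atoms2_12 W A B C) atoms3E; case: a; case: b; cell_cases W A B C.
(* A member is a union of cells of [A] and [B], so a set of pairs of booleans encodes it; there are
   16 such sets. *)
pose phi C := [set p | cell W A B C p.1 p.2 true].
have -> : 16 = #|{set bool * bool}| by rewrite -cardsT -powersetT card_powerset cardsT card_prod card_bool.
rewrite -(@card_in_imset _ _ phi) ?max_card //.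
have half C D : C \in F -> D \in F -> phi C = phi D -> C \subset D.
  move=> CF DF e; apply/subsetP=> x xC; have := FW _ CF; rewrite powersetE => /subsetP/(_ _ xC) xW.
  have : (x \in A, x \in B) \in phi D.
    by rewrite -e inE; apply/cellP; exists x.
  rewrite inE /= => h; apply: contraT => xD; have /negP[] := cstx _ (x \in A) (x \in B) DF.
  by rewrite h; apply/cellP; exists x; rewrite // (negbTE xD).
by move=> C D CF DF e; apply/eqP; rewrite eqEsubset !half.
Qed.

Lemma card_triple_step a d :
  a.+1 < 8 ->
  (forall W F, F \subset powerset W -> triple_le W F a -> #|F| <= 16 * #|W|.+1 ^ d) ->
  forall W F, F \subset powerset W -> triple_le W F a.+1 -> #|F| <= 16 * #|W|.+1 ^ d.+1.
Proof.
move=> a8 IHa W; move: {2}#|W| (erefl #|W|) => m; elim: m W => [|m IHm] W cW F FW tF.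
  rewrite cW; have -> : 16 * 1 ^ d.+1 = 16 by rewrite exp1n.
  apply: leq_trans (subset_leq_card FW) _; by rewrite card_powerset cW.
have [x xW] : exists x, x \in W by apply/set0Pn; rewrite -card_gt0 cW.
have cWx : #|W :\ x| = m by have := cardsD1 x W; rewrite xW cW; lia.
have := IHm _ cWx _ (sub_drop_pt x FW) (triple_drop_pt (x := x) tF).
have := IHa _ _ (sub_link x FW) (triple_link tF a8 xW).
rewrite (card_drop_link x F) cW cWx => h1 h2.
apply: leq_trans (leq_add h2 h1) _; rewrite -mulnDr leq_mul2l /=.
rewrite expnS [X in _ <= X]expnS -[X in _ + X]mul1n -mulnDl addn1 leq_mul2l /=.
by have [->|d0] := posnP d; rewrite ?expn0 ?leq_exp2r.
Qed.

Lemma card_triple4 W F :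
  F \subset powerset W -> triple_le W F 4 -> #|F| <= 16 * #|W|.+1 ^ 1.
Proof.
by apply: card_triple_step => // {}W {}F FW /(card_triple3 FW); rewrite expn0 muln1.
Qed.

Lemma card_triple5 W F :
  F \subset powerset W -> triple_le W F 5 -> #|F| <= 16 * #|W|.+1 ^ 2.
Proof. by apply: card_triple_step => //; apply: card_triple4. Qed.

Lemma card_triple6 W F :
  F \subset powerset W -> triple_le W F 6 -> #|F| <= 16 * #|W|.+1 ^ 3.
Proof. by apply: card_triple_step => //; apply: card_triple5. Qed.

(** An instance of the Sauer-Shelah lemma: more than [1 + 3] patterns in the three-dimensional cube
    shatter some pair of coordinates. *)
Lemma pairs_triple4 W F :
  (forall A B, A \in F -> B \in F -> atoms2 W A B <= 3) -> triple_le W F 4.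
Proof.
move=> h A B C AF BF CF; have := h _ _ AF BF; have := h _ _ AF CF; have := h _ _ BF CF.
rewrite !(atoms2_12 W A B C) !(atoms2_13 W A B C) !(atoms2_23 W A B C) atoms3E.
cell_cases W A B C.
Qed.

End TripleBounds.

(** * Traces of a family on the two sides of a ground set *)

Section Traces.
Local Open Scope nat_scope.
Variable V : finType.
Implicit Types (W P Q N A B C D E : {set V}) (F R : {set {set V}}).

Lemma card_fibers (T U : finType) (S : {set T}) (g : T -> U) (I : {set U}) c :
  {in S, forall x, g x \in I} ->
  (forall y, y \in I -> #|[set x in S | g x == y]| <= c) -> #|S| <= c * #|I|.
Proof.
move=> gI fib; rewrite -sum1_card (partition_big g (mem I)) //= mulnC -sum_nat_const.
apply: leq_sum => y yI; apply: leq_trans (fib y yI); rewrite -sum1_card.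
by apply: eq_leq; apply: eq_bigl => x; rewrite inE.
Qed.

Definition trace P F := [set A :&: P | A in F].

Lemma sub_trace P F : trace P F \subset powerset P.
Proof. by apply/subsetP=> _ /imsetP[A _ ->]; rewrite powersetE subsetIr. Qed.

Lemma mem_trace P F A : A \in F -> A :&: P \in trace P F.
Proof. by move=> AF; apply/imsetP; exists A. Qed.

Lemma in_setIP P A : {in P, A :&: P =i A}.
Proof. by move=> x xP; rewrite inE xP andbT. Qed.

Lemma triple_trace W P F a : P \subset W -> triple_le W F a -> triple_le P (trace P F) a.
Proof.
move=> PW tF _ _ _ /imsetP[A AF ->] /imsetP[B BF ->] /imsetP[C CF ->].
apply: leq_trans (tF _ _ _ AF BF CF).
by apply: atoms3_mono => //; apply: in_setIP.
Qed.

Lemma atoms2_trace P A B : atoms2 P (A :&: P) (B :&: P) = atoms2 P A B.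
Proof. by apply: atoms2_ext; apply: in_setIP. Qed.

Definition splits A P := [exists x in P, x \in A] && [exists x in P, x \notin A].

Lemma splits_1 W A B C : splits A W =
  [|| cell W A B C true true true, cell W A B C true true false,
      cell W A B C true false true | cell W A B C true false false]
  && [|| cell W A B C false true true, cell W A B C false true false,
      cell W A B C false false true | cell W A B C false false false].
Proof.
have h a : [exists x in W, (x \in A) == a] =
  [|| cell W A B C a true true, cell W A B C a true false,
      cell W A B C a false true | cell W A B C a false false].
  apply/exists_inP/or4P => [[x xW /eqP <-]|]; last first.
    by case=> /cellP[x xW [<- _ _]]; exists x.
  case xB : (x \in B); case xC : (x \in C);
    [apply: Or41|apply: Or42|apply: Or43|apply: Or44]; by apply/cellP; exists x.
rewrite -!h; congr (_ && _); apply: eq_existsb => x; case: (x \in A) => //.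
Qed.

Lemma splits_2 W A B C : splits B W =
  [|| cell W A B C true true true, cell W A B C true true false,
      cell W A B C false true true | cell W A B C false true false]
  && [|| cell W A B C true false true, cell W A B C true false false,
      cell W A B C false false true | cell W A B C false false false].
Proof. by rewrite (splits_1 W B A C) !(cell_swap12 W A B C). Qed.

Lemma splits_3 W A B C : splits C W =
  [|| cell W A B C true true true, cell W A B C true false true,
      cell W A B C false true true | cell W A B C false false true]
  && [|| cell W A B C true true false, cell W A B C true false false,
      cell W A B C false true false | cell W A B C false false false].
Proof. by rewrite (splits_2 W A C B) !(cell_swap23 W A B C). Qed.

Lemma splits_ext P A B : {in P, A =i B} -> splits A P = splits B P.
Proof.
by move=> e; rewrite /splits; congr (_ && _); apply: eq_existsb => x;
  case: (boolP (x \in P)) => //= xP; rewrite e.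
Qed.

Lemma eq_on_union W P Q D E :
  W \subset P :|: Q -> D \subset W -> E \subset W ->
  {in P, D =i E} -> {in Q, D =i E} -> D = E.
Proof.
move=> /subsetP WPQ /subsetP DW /subsetP EW eP eQ; apply/setP=> x.
case: (boolP (x \in W)) => [/WPQ|xW].
  by rewrite inE => /orP[/eP|/eQ].
by rewrite (contraNF (DW x)) // (contraNF (EW x)).
Qed.

Lemma setI_eq_in P A B : A :&: P = B :&: P -> {in P, A =i B}.
Proof. by move=> e x xP; move/setP/(_ x): e; rewrite !inE xP !andbT. Qed.

(** With [P] a member and [Q] its complement, this is the six-atom condition on the triple of that
    member, [D] and [E]. For two parts of the greedy partition it comes from the price of two
    cuts. *)
Definition cross_le P Q F :=
  forall D E, D \in F -> E \in F -> atoms2 P D E + atoms2 Q D E <= 6.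

Lemma cross_leC P Q F : cross_le P Q F -> cross_le Q P F.
Proof. by move=> h D E DF EF; rewrite addnC; apply: h. Qed.

(** Traces on [P] with two extensions that split [Q] and are neither equal nor opposite there. *)
Definition free_traces P Q F := [set A in trace P F |
  [exists D in F, exists E in F,
    [&& D :&: P == A, E :&: P == A, splits D Q, splits E Q & 3 <= atoms2 Q D E]]].

Lemma crossing_small P Q F D E : cross_le P Q F -> D \in F -> E \in F ->
  4 <= atoms2 P D E -> atoms2 Q D E <= 2.
Proof.
move=> h DF EF h4; rewrite -(leq_add2l 4).
by apply: leq_trans (h _ _ DF EF); rewrite leq_add2r.
Qed.

(** If two free traces generate four atoms on [P], an extension of the second is equal or opposite
    on [Q] to both extensions of the first, which are then equal or opposite to each other. So two
    free traces generate at most three atoms, and [pairs_triple4] applies. *)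
Lemma card_free_traces P Q F : cross_le P Q F ->
  #|free_traces P Q F| <= 16 * #|P|.+1.
Proof.
move=> crF; rewrite -[#|P|.+1]expn1; apply: card_triple4.
  by apply: subset_trans (sub_trace P F); apply/subsetP=> A; rewrite inE => /andP[].
apply: pairs_triple4 => A B; rewrite !inE.
case/andP=> _ /exists_inP[D DF] /exists_inP[E EF] /and5P[/eqP<- /eqP eE sD sE h3].
case/andP=> _ /exists_inP[D' DF'] /exists_inP[_ _] /and5P[/eqP<- _ sD' _ _].
rewrite leqNgt; apply/negP => h4; move: (h4).
rewrite -eE !atoms2_trace => hE; move: h4; rewrite atoms2_trace => hD.
have := crossing_small crF DF DF' hD; have := crossing_small crF EF DF' hE.
suff : [==> splits D Q, splits E Q, splits D' Q, 3 <= atoms2 Q D E,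
        atoms2 Q E D' <= 2, atoms2 Q D D' <= 2 => false].
  by move=> + hE2 hD2; rewrite sD sE sD' h3 hE2 hD2.
rewrite (splits_1 Q D E D') (splits_2 Q D E D') (splits_3 Q D E D').
rewrite !(atoms2_12 Q D E D') !(atoms2_13 Q D E D') !(atoms2_23 Q D E D').
cell_cases Q D E D'.
Qed.

Lemma same_or_opposite Q D E : splits D Q -> splits E Q -> atoms2 Q D E <= 2 ->
  {in Q, D =i E} \/ {in Q, forall x, (x \in D) = (x \notin E)}.
Proof.
move=> sD sE h2.
have : ~~ (((true, false) \in pat2 D E @: Q) || ((false, true) \in pat2 D E @: Q))
    || ~~ (((true, true) \in pat2 D E @: Q) || ((false, false) \in pat2 D E @: Q)).
  move: sD sE h2; rewrite (splits_1 Q D E E) (splits_2 Q D E E) !(atoms2_12 Q D E E).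
  cell_cases Q D E E.
have pat x a b : x \in Q -> (x \in D) = a -> (x \in E) = b -> (a, b) \in pat2 D E @: Q.
  by move=> xQ xD xE; apply/pat2P; exists x.
case/orP=> h; [left|right] => x xQ; case xD: (x \in D); case xE: (x \in E) => //;
  by move: h; rewrite (pat x _ _ xQ xD xE) ?orbT.
Qed.

(** A trace that is not free has at most two extensions, since any two of them are equal or opposite
    on [Q]. *)
Lemma card_tied P Q R : R \subset powerset (P :|: Q) ->
  {in R, forall D, splits D Q} ->
  #|[set D in R | D :&: P \notin free_traces P Q R]| <= 2 * #|trace P R|.
Proof.
move=> /subsetP RW sR.
apply: (@card_fibers _ _ _ (fun D => D :&: P)) => [D|A _].
  by rewrite inE => /andP[DR _]; apply: mem_trace.
have [->|[D0]] := set_0Vmem [set D in [set D in R | D :&: P \notin free_traces P Q R] | D :&: P == A].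
  by rewrite cards0.
rewrite !inE => /andP[/andP[D0R nX] /eqP eD0].
(* The second set agrees with [D0] on [P] and is its complement on the rest of [Q]; [P] is removed
   because the two sides are not assumed disjoint. *)
apply: leq_trans (_ : #|[set D0; A :|: (Q :\: D0 :\: P)]| <= 2); last first.
  by rewrite cards2; case: (_ != _).
apply: subset_leq_card; apply/subsetP=> E; rewrite !inE => /andP[/andP[ER _] /eqP eE].
have W0 := RW _ D0R; have WE := RW _ ER; rewrite !powersetE in W0 WE.
have h2 : atoms2 Q D0 E <= 2.
  rewrite leqNgt; apply: contra nX => h3; rewrite mem_trace //=.
  apply/exists_inP; exists D0 => //; apply/exists_inP; exists E => //.
  by rewrite eqxx eE eD0 eqxx !sR.
have [e|e] := same_or_opposite (sR _ D0R) (sR _ ER) h2; apply/orP; [left|right].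
  apply/eqP; apply: (eq_on_union (subxx (P :|: Q))) => // [|x xQ]; last by rewrite e.
  by apply: setI_eq_in; rewrite eE.
apply/eqP/setP=> x; rewrite -eE !inE.
case xP : (x \in P); rewrite ?andbT ?andbF ?orbF //=.
case xQ : (x \in Q); rewrite ?andbT ?andbF /=.
  by rewrite (e x xQ) negbK.
by apply/idP => xE; move/subsetP: WE => /(_ x xE); rewrite inE xP xQ.
Qed.

(** Members with a trace that is not free are counted by [card_tied]; the others are determined by a
    pair of free traces, of which there are linearly many on each side. *)
Lemma card_bipartite P Q R : R \subset powerset (P :|: Q) ->
  {in R, forall D, splits D P} -> {in R, forall D, splits D Q} -> cross_le P Q R ->
  #|R| <= 2 * #|trace P R| + 2 * #|trace Q R| + (16 * #|P|.+1) * (16 * #|Q|.+1).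
Proof.
move=> RW sP sQ crR.
have hP := card_tied RW sQ.
have hQ : #|[set D in R | D :&: Q \notin free_traces Q P R]| <= 2 * #|trace Q R|.
  by apply: card_tied => //; rewrite setUC.
have h3 : #|[set D in R | (D :&: P \in free_traces P Q R) && (D :&: Q \in free_traces Q P R)]|
   <= (16 * #|P|.+1) * (16 * #|Q|.+1).
  apply: leq_trans (leq_mul (card_free_traces crR) (card_free_traces (cross_leC crR))).
  rewrite -cardsX -(@card_in_imset _ _ (fun D => (D :&: P, D :&: Q))).
    apply: subset_leq_card; apply/subsetP=> _ /imsetP[D + ->].
    by rewrite inE => /and3P[_ h1 h2]; rewrite inE /= h1 h2.
  move=> D E; rewrite !inE => /and3P[DR _ _] /and3P[ER _ _] [e1 e2].
  move/subsetP: RW => RW; have := RW _ DR; have := RW _ ER; rewrite !powersetE => EW DW.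
  by apply: (eq_on_union (subxx (P :|: Q))) => //; apply: setI_eq_in.
apply: leq_trans (leq_add (leq_add hP hQ) h3).
apply: leq_trans (_ : #|[set D in R | D :&: P \notin free_traces P Q R]
  :|: [set D in R | D :&: Q \notin free_traces Q P R] :|:
  [set D in R | (D :&: P \in free_traces P Q R) && (D :&: Q \in free_traces Q P R)]| <= _).
  apply: subset_leq_card; apply/subsetP=> D DR; rewrite 2!in_setU.
  case hp : (D :&: P \in free_traces P Q R); last by rewrite in_set DR hp.
  case hq : (D :&: Q \in free_traces Q P R); last first.
    by apply/orP; left; apply/orP; right; rewrite in_set DR hq.
  by apply/orP; right; rewrite in_set DR hp hq.
by apply: leq_trans (leq_card_setU _ _) _; rewrite leq_add2r leq_card_setU.
Qed.

Definition multi_traces P F := [set A in trace P F |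
  [exists D in F, exists E in F, [&& D :&: P == A, E :&: P == A & D != E]]].

Definition opposite_traces P N F := [set A in trace P F |
  [exists D in F, exists E in F, [&& D :&: P == A, E :&: P == A &
    [forall n in N, (n \in D) != (n \in E)]]]].

(** One extension splits [N], the other is constantly [t] on it. Fixing the value [b] of the first
    at the point [r] excludes the opposite case of [same_or_opposite]. *)
Definition mixed_traces P N F r (t b : bool) := [set A in trace P F |
  [exists D in F, exists E in F, [&& D :&: P == A, E :&: P == A, splits D N,
    (r \in D) == b & [forall n in N, (n \in E) == t]]]].

Lemma eq_setI_in P A D : D :&: P = A -> {in P, A =i D}.
Proof. by move=> <-; apply: in_setIP. Qed.

(** The two extensions differ at [r], so each such trace is flexible there and the bound on atoms
    drops from 6 to 5. *)
Lemma card_opposite_traces P N F r : triple_le (P :|: N) F 6 -> r \in N ->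
  #|opposite_traces P N F| <= 16 * #|P|.+1 ^ 2.
Proof.
move=> tF rN; apply: card_triple5.
  by apply: subset_trans (sub_trace P F); apply/subsetP=> A; rewrite inE => /andP[].
have fl A : A \in opposite_traces P N F -> flexible F P r A.
  rewrite inE => /andP[_ /exists_inP[D DF /exists_inP[E EF]]].
  case/and3P=> /eqP eD /eqP eE /forall_inP/(_ _ rN) ne b.
  case: (boolP ((r \in D) == b)) => [/eqP rD|rD].
    by exists D => //; split=> //; apply: eq_setI_in.
  exists E => //; split; last exact: eq_setI_in.
  by move: ne rD; case: (r \in D); case: (r \in E); case: b.
move=> A B C /fl fA /fl fB /fl fC.
by apply: (flexible_triple tF _ (subsetUl P N) (x := r)) => //; rewrite inE rN orbT.
Qed.

(** A pair of sets misses an atom only if both ends of an edge of the cube, in the direction of the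
    third set, are missing patterns. Two missing patterns span at most one edge, so at most one pair
    fails. *)
Lemma six_atoms_cross P A B C : 6 <= atoms3 P A B C ->
  [|| (4 <= atoms2 P A B) && (4 <= atoms2 P A C),
      (4 <= atoms2 P A B) && (4 <= atoms2 P B C)
    | (4 <= atoms2 P A C) && (4 <= atoms2 P B C)].
Proof.
rewrite !(atoms2_12 P A B C) !(atoms2_13 P A B C) !(atoms2_23 P A B C) atoms3E.
cell_cases P A B C.
Qed.

(* Six atoms on P force two crossing pairs, so the three lifts which split N
   coincide on N; any n where they differ from the constant t is then free. *)
Lemma card_mixed_traces P N F r t b : triple_le (P :|: N) F 6 -> cross_le P N F ->
  r \in N -> #|mixed_traces P N F r t b| <= 16 * #|P|.+1 ^ 2.
Proof.
move=> tF crF rN; apply: card_triple5.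
  by apply: subset_trans (sub_trace P F); apply/subsetP=> A; rewrite inE => /andP[].
have get A : A \in mixed_traces P N F r t b -> exists D E,
    [/\ D \in F, E \in F, D :&: P = A, E :&: P = A & 
     [/\ splits D N, (r \in D) = b & forall n, n \in N -> (n \in E) = t]].
  rewrite inE => /andP[_ /exists_inP[D DF /exists_inP[E EF]]].
  case/and5P=> /eqP eD /eqP eE sD /eqP rD /forall_inP h.
  by exists D, E; split=> //; split=> // n /h/eqP.
move=> A B C /get[D1 [E1 [D1F E1F eD1 eE1 [sD1 rD1 cE1]]]].
move=> /get[D2 [E2 [D2F E2F eD2 eE2 [sD2 rD2 cE2]]]].
move=> /get[D3 [E3 [D3F E3F eD3 eE3 [sD3 rD3 cE3]]]].
rewrite leqNgt; apply/negP => h6.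
have same D E : D \in F -> E \in F -> splits D N -> splits E N -> (r \in D) = b ->
    (r \in E) = b -> 4 <= atoms2 P (D :&: P) (E :&: P) -> {in N, D =i E}.
  move=> DF EF sD sE rD rE; rewrite atoms2_trace => h4.
  have [//|op] := same_or_opposite sD sE (crossing_small crF DF EF h4).
  by have := op _ rN; rewrite rD rE; case: (b).
have [e12 e13] : {in N, D1 =i D2} /\ {in N, D1 =i D3}.
  have := six_atoms_cross h6; rewrite -{1 2 3 4}eD1 -{1 2 3 4}eD2 -eD3.
  case/or3P=> /andP[c1 c2].
  - by split; apply: same.
  - have e1 : {in N, D1 =i D2} by apply: same.
    have e2 : {in N, D2 =i D3} by apply: same.
    by split=> // n nN; rewrite e1 ?e2.
  - have e1 : {in N, D1 =i D3} by apply: same.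
    have e2 : {in N, D2 =i D3} by apply: same.
    by split=> // n nN; rewrite e1 ?e2.
have [n nN nD] : exists2 n, n \in N & (n \in D1) = ~~ t.
  case/andP: sD1 => /exists_inP[x xN xD] /exists_inP[y yN yD].
  by case: (t); [exists y => //; apply: negbTE|exists x].
have fl A' D E : D \in F -> E \in F -> D :&: P = A' -> E :&: P = A' ->
    (n \in D) = ~~ t -> (n \in E) = t -> flexible F P n A'.
  move=> DF EF eD eE nD' nE' c; case: (boolP (c == t)) => [/eqP ->|ct].
    by exists E => //; split=> //; apply: eq_setI_in.
  exists D => //; split; last exact: eq_setI_in.
  by rewrite nD'; move: ct; case: (c); case: (t).
have nW : n \in P :|: N by rewrite inE nN orbT.
have := flexible_triple tF isT (subsetUl P N) nW (fl _ _ _ D1F E1F eD1 eE1 nD (cE1 _ nN)).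
move=> /(_ _ _ (fl _ _ _ D2F E2F eD2 eE2 _ (cE2 _ nN)) (fl _ _ _ D3F E3F eD3 eE3 _ (cE3 _ nN))).
by rewrite -e12 // -e13 // leqNgt h6 => /(_ nD nD).
Qed.

(** Two extensions of one trace differ on [N]. If both split [N], they generate three atoms there or
    are opposite; if just one does, the trace is mixed; if neither does, they are distinct constants
    on [N], hence opposite. Six classes of at most [16 * #|P|.+1 ^ 2] traces give 96. *)
Lemma card_multi_traces P N F : F \subset powerset (P :|: N) ->
  triple_le (P :|: N) F 6 -> cross_le P N F -> N != set0 ->
  #|multi_traces P F| <= 96 * #|P|.+1 ^ 2.
Proof.
move=> FW tF crF /set0Pn[r rN].
have sub : multi_traces P F \subset
    free_traces P N F :|: opposite_traces P N F :|:
    mixed_traces P N F r true true :|: mixed_traces P N F r true false :|: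
    mixed_traces P N F r false true :|: mixed_traces P N F r false false.
  apply/subsetP=> A; rewrite inE => /andP[AT /exists_inP[D DF /exists_inP[E EF]]].
  case/and3P=> /eqP eD /eqP eE nDE.
  have mixed D' E' t : D' \in F -> E' \in F -> D' :&: P = A -> E' :&: P = A ->
      splits D' N -> {in N, forall n, (n \in E') = t} ->
      A \in mixed_traces P N F r t (r \in D').
    move=> D'F E'F eD' eE' sD' cE'; rewrite inE AT; apply/exists_inP; exists D' => //.
    apply/exists_inP; exists E' => //; rewrite eD' eE' sD' !eqxx /=.
    by apply/forall_inP=> n /cE' ->.
  have unsplit D' : ~~ splits D' N -> exists t, {in N, forall n, (n \in D') = t}.
    rewrite negb_and => /orP[h|h]; [exists false|exists true] => n nN.
      by apply: contraNF h => nD; apply/exists_inP; exists n.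
    by apply: contraNT h => nD; apply/exists_inP; exists n.
  have neN : ~ {in N, D =i E}.
    move=> e; case/eqP: nDE; move/subsetP: FW => FW.
    apply: (eq_on_union (subxx (P :|: N))); rewrite -?powersetE ?FW //.
    by apply: setI_eq_in; rewrite eD eE.
  have opp : {in N, forall x, (x \in D) = (x \notin E)} -> A \in opposite_traces P N F.
    move=> h; rewrite inE AT; apply/exists_inP; exists D => //.
    apply/exists_inP; exists E => //; rewrite eD eE !eqxx /=.
    by apply/forall_inP=> n /h ->; case: (n \in E).
  have mix t b : A \in mixed_traces P N F r t b -> A \in
    free_traces P N F :|: opposite_traces P N F :|:
    mixed_traces P N F r true true :|: mixed_traces P N F r true false :|:
    mixed_traces P N F r false true :|: mixed_traces P N F r false false.
    by rewrite !in_setU; case: t; case: b => ->; rewrite ?orbT.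
  case: (boolP (splits D N)) (boolP (splits E N)) => [sD|nsD] [sE|nsE].
  - case: (leqP 3 (atoms2 N D E)) => h3.
      rewrite !in_setU; apply/orP; left; do 4![apply/orP; left].
      rewrite inE AT; apply/exists_inP; exists D => //.
      by apply/exists_inP; exists E => //; rewrite eD eE sD sE !eqxx.
    have [//|/opp h] := same_or_opposite sD sE h3.
    by rewrite !in_setU h !orbT.
  - by have [t ct] := unsplit _ nsE; apply: (mix t (r \in D)); apply: mixed ct.
  - by have [t ct] := unsplit _ nsD; apply: (mix t (r \in E)); apply: mixed ct.
  - have [t ct] := unsplit _ nsD; have [u cu] := unsplit _ nsE.
    have h : A \in opposite_traces P N F.
      apply: opp => x xN; rewrite ct // cu //.
      have : t != u by apply/eqP => tu; apply: neN => n nN; rewrite ct // cu.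
      by case: (t); case: (u).
    by rewrite !in_setU h !orbT.
apply: leq_trans (subset_leq_card sub) _.
have -> : 96 * #|P|.+1 ^ 2 = 16 * #|P|.+1 ^ 2 + 16 * #|P|.+1 ^ 2 + 16 * #|P|.+1 ^ 2
   + 16 * #|P|.+1 ^ 2 + 16 * #|P|.+1 ^ 2 + 16 * #|P|.+1 ^ 2 by rewrite -!mulnDl.
do 4![apply: leq_trans (leq_card_setU _ _) _;
      apply: leq_add; last exact: card_mixed_traces tF crF rN].
apply: leq_trans (leq_card_setU _ _) _.
apply: leq_add; last exact: card_opposite_traces tF rN.
apply: leq_trans (card_free_traces crF) _.
by rewrite leq_mul2l /= expnS leq_pmulr // expn_gt0.
Qed.

End Traces.

(** * Splitting a family along one of its members *)

Section SplitAlong.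
Local Open Scope nat_scope.
Variable V : finType.
Implicit Types (W P Q N A B C D E : {set V}) (F G R : {set {set V}}).

Lemma atoms3_member W C D E : C \subset W ->
  atoms3 W C D E = atoms2 C D E + atoms2 (W :\: C) D E.
Proof.
move=> /subsetP CW.
have hC b c : ((b, c) \in pat2 D E @: C) = cell W C D E true b c.
  apply/pat2P/cellP => [[x xC [<- <-]]|[x xW [xC <- <-]]]; exists x => //.
  exact: CW.
have hN b c : ((b, c) \in pat2 D E @: (W :\: C)) = cell W C D E false b c.
  apply/pat2P/cellP => [[x + [<- <-]]|[x xW [xC <- <-]]].
    by rewrite inE => /andP[/negbTE xC xW]; exists x.
  by exists x; rewrite // inE xC xW.
by rewrite !atoms2E !hC !hN atoms3E !addnA.
Qed.

Lemma cross_le_member W F C : C \in F -> C \subset W -> triple_le W F 6 ->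
  cross_le C (W :\: C) F.
Proof. by move=> CF CW tF D E DF EF; rewrite -atoms3_member // tF. Qed.

(** A set that is constant on [N] is its trace on [P], possibly enlarged by all of [N]. *)
Lemma card_unsplit P N G (I : {set {set V}}) : G \subset powerset (P :|: N) ->
  {in G, forall D, ~~ splits D N} -> {in G, forall D, D :&: P \in I} ->
  #|G| <= 2 * #|I|.
Proof.
move=> /subsetP GW nG GI; apply: (@card_fibers _ _ _ (fun D => D :&: P)) => // A _.
apply: leq_trans (_ : #|[set A; A :|: N]| <= 2); last by rewrite cards2; case: (_ != _).
apply: subset_leq_card; apply/subsetP=> D; rewrite 3!inE => /andP[DG /eqP eD].
have := GW _ DG; rewrite powersetE => DW; have := nG _ DG.
rewrite negb_and in_set1 => /orP[h|h]; apply/orP; [left|right].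
  rewrite -eD eq_sym; apply/eqP/setIidPl/subsetP=> x xD.
  move/subsetP: DW => /(_ x xD); rewrite inE => /orP[//|xN].
  by case/negP: h; apply/exists_inP; exists x.
rewrite -eD; apply/eqP/setP=> x; rewrite !inE.
case xN : (x \in N); last first.
  rewrite orbF; case xP : (x \in P); rewrite ?andbT ?andbF //.
  by apply/idP => xD; move/subsetP: DW => /(_ x xD); rewrite inE xP xN.
by rewrite orbT; apply: contraNT h => xD; apply/exists_inP; exists x.
Qed.

Lemma card_unique_traces P F :
  #|[set D in F | D :&: P \notin multi_traces P F]| <= #|trace P F|.
Proof.
rewrite -[X in X <= _](@card_in_imset _ _ (fun D => D :&: P)).
  by apply: subset_leq_card; apply/subsetP=> _ /imsetP[D + ->]; rewrite inE => /andP[DF _];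
    apply: mem_trace.
move=> D E; rewrite !in_set => /andP[DF nD] /andP[EF _] e; apply/eqP.
apply: contraR nD => nDE; rewrite mem_trace //=.
apply/exists_inP; exists D => //; apply/exists_inP; exists E => //.
by rewrite e !eqxx nDE.
Qed.

(** A member whose trace on [C] or on the complement is shared by no other member is charged to that
    trace, with coefficient one because the bound will be iterated. Of the rest, those failing to
    split one side fall under [card_unsplit], those splitting both under [card_bipartite]. Each
    multiple trace is charged at most four times, and [384 = 4 * 96]. *)
Lemma card_split W F C : F \subset powerset W -> triple_le W F 6 ->
  C \in F -> C != set0 -> W :\: C != set0 ->
  #|F| <= #|trace C F| + #|trace (W :\: C) F| +
    (384 * #|C|.+1 ^ 2 + 384 * #|W :\: C|.+1 ^ 2 +
     (16 * #|C|.+1) * (16 * #|W :\: C|.+1)).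
Proof.
move=> FW tF CF C0 N0; set N := W :\: C.
have CW : C \subset W by rewrite -powersetE (subsetP FW).
have eW : C :|: N = W by rewrite /N setDE setUIr setUCr setIT; apply/setUidPr.
have crF : cross_le C N F by apply: cross_le_member.
have mC : #|multi_traces C F| <= 96 * #|C|.+1 ^ 2.
  by apply: (@card_multi_traces _ _ N); rewrite ?eW.
have mN : #|multi_traces N F| <= 96 * #|N|.+1 ^ 2.
  by apply: (@card_multi_traces _ _ C); rewrite ?[N :|: C]setUC ?eW //; apply: cross_leC.
pose G := [set D in F | (D :&: C \in multi_traces C F) && (D :&: N \in multi_traces N F)].
have GF : G \subset F by apply/subsetP=> D; rewrite in_set => /andP[].
have GW : G \subset powerset (C :|: N) by rewrite eW; apply: subset_trans GF FW.
have inC : {in G, forall D, D :&: C \in multi_traces C F}.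
  by move=> D; rewrite in_set => /and3P[].
have inN : {in G, forall D, D :&: N \in multi_traces N F}.
  by move=> D; rewrite in_set => /and3P[].
pose G1 := [set D in G | ~~ splits D N]; pose G2 := [set D in G | ~~ splits D C].
pose G3 := [set D in G | splits D C && splits D N].
have h1 : #|G1| <= 2 * #|multi_traces C F|.
  apply: (@card_unsplit C N).
  - by apply: subset_trans GW; apply/subsetP=> D; rewrite inE => /andP[].
  - by move=> D; rewrite in_set => /andP[].
  - by move=> D; rewrite in_set => /andP[/inC].
have h2 : #|G2| <= 2 * #|multi_traces N F|.
  apply: (@card_unsplit N C).
  - by rewrite setUC; apply: subset_trans GW; apply/subsetP=> D; rewrite inE => /andP[].
  - by move=> D; rewrite in_set => /andP[].
  - by move=> D; rewrite in_set => /andP[/inN].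
have h3 : #|G3| <= 2 * #|multi_traces C F| + 2 * #|multi_traces N F| +
    (16 * #|C|.+1) * (16 * #|N|.+1).
  have G3G D : D \in G3 -> D \in G by rewrite in_set => /andP[].
  apply: leq_trans (card_bipartite (P := C) (Q := N) _ _ _ _) _.
  - by apply: subset_trans GW; apply/subsetP.
  - by move=> D; rewrite in_set => /and3P[].
  - by move=> D; rewrite in_set => /and3P[].
  - by move=> D E /G3G/(subsetP GF) DF /G3G/(subsetP GF) EF; apply: crF.
  rewrite leq_add2r; apply: leq_add; rewrite leq_mul2l /=; apply: subset_leq_card.
    by apply/subsetP=> _ /imsetP[D /G3G DG ->]; apply: inC.
  by apply/subsetP=> _ /imsetP[D /G3G DG ->]; apply: inN.
have hG : #|G| <= #|G1| + #|G2| + #|G3|.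
  apply: leq_trans (_ : #|G1 :|: G2 :|: G3| <= _); last first.
    by apply: leq_trans (leq_card_setU _ _) _; rewrite leq_add2r leq_card_setU.
  apply: subset_leq_card; apply/subsetP=> D DG; rewrite !in_setU ![_ \in [set _ in G | _]]in_set DG /=.
  by case: (splits D C); case: (splits D N).
have hF : #|F| <= #|trace C F| + #|trace N F| + #|G|.
  apply: leq_trans (leq_add (leq_add (card_unique_traces C F) (card_unique_traces N F)) (leqnn _)).
  apply: leq_trans (_ : #|[set D in F | D :&: C \notin multi_traces C F] :|:
     [set D in F | D :&: N \notin multi_traces N F] :|: G| <= _); last first.
    by apply: leq_trans (leq_card_setU _ _) _; rewrite leq_add2r leq_card_setU.
  apply: subset_leq_card; apply/subsetP=> D DF; rewrite 2!in_setU.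
  case hp : (D :&: C \in multi_traces C F); last by rewrite in_set DF hp.
  case hq : (D :&: N \in multi_traces N F); last first.
    by apply/orP; left; apply/orP; right; rewrite in_set DF hq.
  by apply/orP; right; rewrite in_set DF hp hq.
apply: leq_trans hF _; rewrite leq_add2l; apply: leq_trans hG _.
move: h1 h2 h3 mC mN; clear.
move: #|G1| #|G2| #|G3| #|multi_traces C F| #|multi_traces N F|
  ((16 * #|C|.+1) * (16 * #|N|.+1)) (#|C|.+1 ^ 2) (#|N|.+1 ^ 2).
by move=> g1 g2 g3 mC mN x y z; lia.
Qed.

End SplitAlong.

(** * Families of small members in which every covered pair is heavy *)

Section SmallMembers.
Local Open Scope nat_scope.
Variable V : finType.
Implicit Types (W A B C D E M : {set V}).

(** Removing the elements incident to a sparse index loses at most [t] of them and uses up that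
    index, since no remaining element is incident to it. *)
Lemma card_degenerate (T I : finType) (inc : I -> T -> bool) t (F : {set T}) (J : {set I}) :
  (forall G : {set T}, G \subset F -> G != set0 ->
     exists i x, [/\ i \in J, x \in G, inc i x & #|[set y in G | inc i y]| <= t]) ->
  #|F| <= #|J| * t.
Proof.
move: {2}#|J| (erefl #|J|) => n; elim: n J F => [|n IHn] J F cJ H.
  have [->|F0] := eqVneq F set0; first by rewrite cards0.
  have [i [C [iJ _ _ _]]] := H F (subxx _) F0.
  by move: cJ; rewrite (cardsD1 i) iJ.
have [->|F0] := eqVneq F set0; first by rewrite cards0.
have [i [C [iJ _ _ ct]]] := H F (subxx _) F0.
have cJ' : #|J :\ i| = n by apply: succn_inj; rewrite -cJ [in RHS](cardsD1 i) iJ.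
have hF : #|[set y in F | ~~ inc i y]| <= #|J :\ i| * t.
  apply: IHn => // G GF G0; have [|j [D [jJ DG jD jt]]] := H G _ G0.
    by apply: subset_trans GF _; apply/subsetP=> D; rewrite inE => /andP[].
  exists j, D; split=> //; rewrite !inE jJ andbT; apply: contraTneq jD => ->.
  by move/subsetP: GF => /(_ _ DG); rewrite inE => /andP[].
rewrite (cardsD1 i) iJ mulnDl mul1n.
apply: leq_trans (leq_add ct hF).
apply: leq_trans (leq_card_setU _ _); apply: subset_leq_card.
by apply/subsetP=> D DF; rewrite !inE DF /=; case: (inc i D).
Qed.

Section Heavy.
Variables (W : {set V}) (G : {set {set V}}) (s : nat).
Hypothesis GW : G \subset powerset W.
Hypothesis tG : triple_le W G 6.
Hypothesis sG : forall A, A \in G -> #|A| <= s.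
Hypothesis sW : 3 * s < #|W|.
Hypothesis heavy : forall C x y, C \in G -> x \in C -> y \in C -> x != y ->
  16 * (2 * s).+1 ^ 3 < #|[set D in G | (x \in D) && (y \in D)]|.

Definition top D := maxset (fun A => A \in G) D.

Lemma top_in D : top D -> D \in G.
Proof. by case/maxsetP. Qed.

Lemma top_eq D E : top D -> E \in G -> D \subset E -> E = D.
Proof. by case/maxsetP => _; apply. Qed.

Lemma heavy_in D x : D \in G -> x \in D -> x \in W.
Proof. by move=> /(subsetP GW); rewrite powersetE => /subsetP; apply. Qed.

(** By [card_triple6], too few members fit inside [M] to account for all members through a heavy
    pair. Hence one of them leaves [M], and so does any top set above it. *)
Lemma heavy_extend C x y M : C \in G -> x \in C -> y \in C -> x != y ->
  M \subset W -> #|M| <= 2 * s ->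
  exists2 D, top D & [/\ x \in D, y \in D & ~~ (D \subset M)].
Proof.
move=> CG xC yC xy MW Ms.
have [D /and4P[DG xD yD DM]] : exists D, [&& D \in G, x \in D, y \in D & ~~ (D \subset M)].
  apply/existsP; apply: contraTT (heavy CG xC yC xy) => /existsPn h.
  rewrite -leqNgt; pose H := [set D in G | (x \in D) && (y \in D)].
  have HM : H \subset powerset M.
    apply/subsetP=> D; rewrite !inE => /and3P[DG xD yD].
    by have := h D; rewrite DG xD yD negbK.
  have HG : H \subset G by apply/subsetP=> D; rewrite inE => /andP[].
  apply: leq_trans (card_triple6 HM (triple_sub HG MW tG)) _.
  by rewrite leq_mul2l /= leq_exp2r.
have [E tE DE] := maxset_exists (P := fun A => A \in G) DG.
exists E => //; split; rewrite ?(subsetP DE) //.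
by apply: contra DM => /(subset_trans DE).
Qed.

Lemma cell_outside D1 D2 D3 : D1 \in G -> D2 \in G -> D3 \in G ->
  cell W D1 D2 D3 false false false.
Proof.
move=> G1 G2 G3.
have : ~~ (W \subset D1 :|: D2 :|: D3).
  apply: contraL sW => /subset_leq_card h; rewrite -leqNgt; apply: leq_trans h _.
  apply: leq_trans (leq_card_setU _ _) _; rewrite !mulSn mul0n addn0 addnA leq_add ?sG //.
  by apply: leq_trans (leq_card_setU _ _) _; rewrite leq_add ?sG.
case/subsetPn=> x xW; rewrite !inE !negb_or => /andP[/andP[x1 x2] x3].
by apply/cellP; exists x; rewrite // !(negbTE x1, negbTE x2, negbTE x3).
Qed.

Definition good D1 D2 D3 := [&& top D1, top D2 & top D3] &&
  [&& cell W D1 D2 D3 true true false, cell W D1 D2 D3 true false true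
    & cell W D1 D2 D3 false true true].

Lemma cell_mem D1 D2 D3 a b c x : x \in W -> (x \in D1) = a -> (x \in D2) = b ->
  (x \in D3) = c -> cell W D1 D2 D3 a b c.
Proof. by move=> xW x1 x2 x3; apply/cellP; exists x. Qed.

(* If D1 is inside D2 :|: D3, swap it for a top set sticking out and containing
   the two chosen points; either the swap enlarges the union, or D1 swallows
   D2 :&: D3 and seven atoms appear since top sets are not nested. *)
Lemma good_private D1 D2 D3 : good D1 D2 D3 ->
  (forall E1 E2 E3, good E1 E2 E3 -> #|E1 :|: E2 :|: E3| <= #|D1 :|: D2 :|: D3|) ->
  cell W D1 D2 D3 true false false.
Proof.
case/andP=> /and3P[t1 t2 t3] /and3P[c1 c2 c3] hmax; apply: contraT => npriv.
have /cellP[z zW [z1 z2 z3]] := c1.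
have /cellP[a aW [a1 a2 a3]] := c2.
have /cellP[y yW [y1 y2 y3]] := c3.
have sub1 : D1 \subset D2 :|: D3.
  apply/subsetP=> x xD; rewrite inE; case x2 : (x \in D2) => //; case x3 : (x \in D3) => //.
  by rewrite (cell_mem (heavy_in (top_in t1) xD) xD x2 x3) in npriv.
have az : a != z by apply: contraFneq a2 => ->.
have MW : D2 :|: D3 \subset W.
  by apply/subsetP=> x; rewrite inE => /orP[]; apply: heavy_in; apply: top_in.
have Ms : #|D2 :|: D3| <= 2 * s.
  apply: leq_trans (leq_card_setU _ _) _.
  by rewrite mulSn mul1n leq_add // sG // top_in.
have [D tD [aD zD /subsetPn[p pD]]] := heavy_extend (top_in t1) a1 z1 az MW Ms.
rewrite inE negb_or => /andP[/negbTE p2 /negbTE p3].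
case h : (cell W D D2 D3 false true true).
  have gD : good D D2 D3 by rewrite /good tD t2 t3 h (cell_mem zW zD z2 z3) (cell_mem aW aD a2 a3).
  have := hmax _ _ _ gD; rewrite leqNgt -!setUA => /negP[]; apply: proper_card.
  rewrite (setUidPr sub1); apply/properP; split; first exact: subsetUr.
  by exists p; rewrite !inE ?pD // p2 p3.
have notin u : u \in D2 -> u \in D3 -> u \in D.
  move=> u2 u3; apply: contraFT h => uD.
  by apply: (cell_mem (heavy_in (top_in t2) u2)) => //; apply: negbTE.
have [u u2 uD] : exists2 u, u \in D2 & u \notin D.
  by apply/subsetPn; apply: contraFN a2 => /(top_eq t2 (top_in tD)) <-.
have [v v3 vD] : exists2 v, v \in D3 & v \notin D.
  by apply/subsetPn; apply: contraFN z3 => /(top_eq t3 (top_in tD)) <-.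
have u3 : (u \in D3) = false by apply: contraNF uD => ?; apply: notin.
have v2 : (v \in D2) = false by apply: contraNF vD => ?; apply: notin.
have := tG (top_in tD) (top_in t2) (top_in t3); rewrite atoms3E.
rewrite (cell_mem yW (notin _ y2 y3) y2 y3) (cell_mem zW zD z2 z3) (cell_mem aW aD a2 a3).
rewrite (cell_mem (heavy_in (top_in tD) pD) pD p2 p3).
rewrite (cell_mem (heavy_in (top_in t2) u2) (negbTE uD) u2 u3).
rewrite (cell_mem (heavy_in (top_in t3) v3) (negbTE vD) v2 v3).
by rewrite (cell_outside (top_in tD) (top_in t2) (top_in t3)); case: (cell _ _ _ _ _ _ _).
Qed.

(** In a good triple with the largest union, [good_private] applies to each of the three sets. The
    three private cells, the three pair cells and the outside cell are seven atoms. *)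
Lemma not_good D1 D2 D3 : ~~ good D1 D2 D3.
Proof.
apply/negP => g0.
case: (@arg_maxnP _ (D1, D2, D3) (fun p => good p.1.1 p.1.2 p.2)
  (fun p => #|p.1.1 :|: p.1.2 :|: p.2|) g0) => -[[E1 E2] E3] /= g hmax.
have hm A1 A2 A3 : good A1 A2 A3 -> #|A1 :|: A2 :|: A3| <= #|E1 :|: E2 :|: E3|.
  by move=> gA; apply: (hmax (A1, A2, A3)).
have c1 := good_private g hm.
have g2 : good E2 E1 E3.
  move: g; rewrite /good !(cell_swap12 W E1 E2 E3) => /andP[/and3P[-> -> ->] /and3P[-> -> ->]].
  by [].
have g3 : good E3 E1 E2.
  move: g; rewrite /good !(cell_swap12 W E1 E3 E2) !(cell_swap23 W E1 E2 E3).
  by move=> /andP[/and3P[-> -> ->] /and3P[-> -> ->]].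
have c2 : cell W E1 E2 E3 false true false.
  rewrite -cell_swap12; apply: good_private g2 _ => A1 A2 A3 /hm.
  by rewrite [E2 :|: E1]setUC.
have c3 : cell W E1 E2 E3 false false true.
  rewrite -cell_swap23 -cell_swap12; apply: good_private g3 _ => A1 A2 A3 /hm.
  by rewrite -(setUA E3) (setUC E3).
case/andP: g => /and3P[t1 t2 t3] /and3P[p1 p2 p3].
have := tG (top_in t1) (top_in t2) (top_in t3); rewrite atoms3E c1 c2 c3 p1 p2 p3.
by rewrite (cell_outside (top_in t1) (top_in t2) (top_in t3)); case: (cell _ _ _ _ _ _ _).
Qed.

(** By [not_good] the sets [D] and [E] share no point outside [C], so each has its own cell there.
    With the cells of [x1], [x2], [x3] and the outside cell this makes six atoms, and a point of [C]
    missed by both [D] and [E] would give a seventh. *)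
Lemma traces_cover C D E x1 x2 x3 x4 : top C -> top D -> top E ->
  ~~ (D \subset C) -> ~~ (E \subset C) ->
  x1 \in C -> x1 \in D -> x1 \notin E -> x2 \in C -> x2 \in E -> x2 \notin D ->
  x3 \in C -> x3 \in D -> x3 \in E -> x4 \in C -> x4 \notin D -> x4 \in E.
Proof.
move=> tC tD tE nDC nEC x1C x1D x1E x2C x2E x2D x3C x3D x3E x4C x4D.
apply: contraT => x4E; case/subsetPn: nDC => d dD dC; case/subsetPn: nEC => e eE eC.
have inW u : u \in C -> u \in W by apply: heavy_in; apply: top_in.
have k1 := cell_mem (inW _ x1C) x1C x1D (negbTE x1E).
have k2 := cell_mem (inW _ x2C) x2C (negbTE x2D) x2E.
have nc : cell W C D E false true true = false.
  by apply/negbTE; apply: contra (not_good C D E) => c; rewrite /good tC tD tE k1 k2 c.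
have dE : (d \in E) = false.
  apply: contraFF nc => dE; exact: cell_mem (heavy_in (top_in tD) dD) (negbTE dC) dD dE.
have eD : (e \in D) = false.
  apply: contraFF nc => eD; exact: cell_mem (heavy_in (top_in tE) eE) (negbTE eC) eD eE.
have := tG (top_in tC) (top_in tD) (top_in tE); rewrite atoms3E k1 k2.
rewrite (cell_mem (inW _ x3C) x3C x3D x3E).
rewrite (cell_mem (inW _ x4C) x4C (negbTE x4D) (negbTE x4E)).
rewrite (cell_mem (heavy_in (top_in tD) dD) (negbTE dC) dD dE).
rewrite (cell_mem (heavy_in (top_in tE) eE) (negbTE eC) eD eE).
by rewrite (cell_outside (top_in tC) (top_in tD) (top_in tE)); case: (cell _ _ _ _ _ _ _).
Qed.

(** Inside a top set [C] with two points, extremal choices among the traces on [C] of top sets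
    leaving [C] produce a good triple, which [not_good] forbids. *)
Lemma heavy_small B : B \in G -> #|B| <= 1.
Proof.
move=> BG; rewrite leqNgt; apply/negP => B2.
have [C tC BC] := maxset_exists (P := fun A => A \in G) BG.
have C2 : 1 < #|C| := leq_trans B2 (subset_leq_card BC).
have CG := top_in tC.
have CW : C \subset W by have := subsetP GW _ CG; rewrite powersetE.
have Cs : #|C| <= 2 * s by rewrite (leq_trans (sG CG)) // leq_pmull.
have pair x y : x \in C -> y \in C -> x != y ->
    exists2 D, top D && ~~ (D \subset C) & x \in D /\ y \in D.
  move=> xC yC xy; have [D tD [xD yD DC]] := heavy_extend CG xC yC xy CW Cs.
  by exists D; rewrite ?tD.
have [x0 [y0 [x0C y0C xy0]]] : exists x y, [/\ x \in C, y \in C & x != y].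
  case/card_gt1P: C2 => x [y [xC yC xy]]; by exists x, y.
have [D0 D0top [x0D _]] := pair _ _ x0C y0C xy0.
(* [D1] leaves [C] and has the largest trace on [C]. *)
case: (@arg_maxnP _ D0 (fun D => top D && ~~ (D \subset C)) (fun D => #|D :&: C|) D0top)
  => D1 /andP[t1 n1] max1.
have lt1 D E w : {in C, forall u, u \in D -> u \in E} -> w \in C -> w \in E -> w \notin D ->
    #|D :&: C| < #|E :&: C|.
  move=> DE wC wE wD; apply: proper_card; apply/properP; split.
    by apply/subsetP=> u; rewrite !inE => /andP[uD uC]; rewrite uC DE.
  by exists w; rewrite !inE wC ?wE // (negbTE wD).
have [x xC xD1] : exists2 x, x \in C & x \in D1.
  have : 0 < #|D1 :&: C|.
    apply: leq_trans (max1 _ D0top); rewrite card_gt0; apply/set0Pn; exists x0.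
    by rewrite inE x0D.
  by rewrite card_gt0 => /set0Pn[x]; rewrite inE => /andP[xD xC]; exists x.
have [y yC yD1] : exists2 y, y \in C & y \notin D1.
  apply/subsetPn; apply: contra n1 => CD1.
  by rewrite (top_eq tC (top_in t1) CD1).
have xy : x != y by apply: contraNneq yD1 => <-.
have [B0 B0top [xB0 yB0]] := pair _ _ xC yC xy.
have B0P : [&& top B0 && ~~ (B0 \subset C), y \in B0 & [exists u in C, (u \in B0) && (u \in D1)]].
  by rewrite B0top yB0; apply/exists_inP; exists x; rewrite // xB0 xD1.
(* [D2] also contains [y], a point of [C] outside [D1], meets [D1] inside [C], and has the largest
   trace under these conditions. *)
case: (@arg_maxnP _ B0 (fun D => [&& top D && ~~ (D \subset C), y \in D &
   [exists u in C, (u \in D) && (u \in D1)]]) (fun D => #|D :&: C|) B0P) => D2.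
case/and3P=> /andP[t2 n2] yD2 _ max2.
(* A set through [y] whose trace contained that of [D1] would have a strictly larger trace, against
   the choice of [D1]. *)
have escape D : top D -> ~~ (D \subset C) -> y \in D ->
    exists2 u, u \in C & (u \in D1) && (u \notin D).
  move=> tD nD yD; apply/exists_inP; apply: contraT => /exists_inPn h.
  have : #|D1 :&: C| < #|D :&: C|.
    apply: (lt1 D1 D y) => // u uC uD1; have := h u uC; rewrite uD1 /=.
    by rewrite negbK.
  by rewrite ltnNge => /negP[]; apply: max1; rewrite tD.
have [a aC /andP[aD1 aD2]] := escape D2 t2 n2 yD2.
have ay : a != y by apply: contraTneq aD1 => ->.
have [D3 /andP[t3 n3] [aD3 yD3]] := pair _ _ aC yC ay.
(* [D3] satisfies the conditions on [D2], since it meets [D1] at [a]. As [a] is outside [D2], a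
   trace of [D3] containing that of [D2] would be strictly larger. *)
have [z zC /andP[zD2 zD3]] : exists2 z, z \in C & (z \in D2) && (z \notin D3).
  apply/exists_inP; apply: contraT => /exists_inPn h.
  have : #|D2 :&: C| < #|D3 :&: C|.
    apply: (lt1 D2 D3 a) => // u uC uD2; have := h u uC; rewrite uD2 /=.
    by rewrite negbK.
  rewrite ltnNge => /negP[]; apply: max2; rewrite t3 n3 yD3 /=; apply/exists_inP; exists a => //.
  by rewrite aD3 aD1.
have [w wC /andP[wD1 wD3]] := escape D3 t3 n3 yD3.
have zD1 : z \in D1.
  exact: (traces_cover (x1 := y) (x2 := w) (x3 := a) (x4 := z) tC t3 t1).
(* The points [z], [a], [y] realize the patterns 110, 101, 011. *)
have /negP[] := not_good D1 D2 D3; rewrite /good t1 t2 t3 /=.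
have inW u : u \in C -> u \in W by apply: heavy_in.
rewrite (cell_mem (inW _ zC) zD1 zD2 (negbTE zD3)).
rewrite (cell_mem (inW _ aC) aD1 (negbTE aD2) aD3).
by rewrite (cell_mem (inW _ yC) (negbTE yD1) yD2 yD3).
Qed.

End Heavy.
End SmallMembers.

(** * Bounds for six and seven atoms with a saving of a fourth root *)

Section FamilyBounds.
Local Open Scope nat_scope.
Variable V : finType.
Implicit Types (W A B C D E : {set V}) (F G : {set {set V}}).

Lemma card_le1 W F : F \subset powerset W -> #|[set A in F | #|A| <= 1]| <= #|W|.+1.
Proof.
move=> /subsetP FW; apply: leq_trans (_ : #|set0 |: [set [set x] | x in W]| <= _).
  apply: subset_leq_card; apply/subsetP=> A; rewrite inE => /andP[/FW + A1].
  rewrite powersetE !inE -cards_eq0; case e : #|A| A1 => [|[|//]] _ // AW.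
  move/eqP/cards1P: e AW => [x ->]; rewrite sub1set => xW; apply/orP; right.
  by apply/imsetP; exists x.
apply: leq_trans (leq_card_setU _ _) _; rewrite cards1 add1n ltnS.
exact: leq_imset_card.
Qed.

(** If [#|W| <= 3 * s], the cubic bound suffices. Otherwise [card_degenerate], with ordered pairs of
    points as indices, removes all members of size at least 2, because [heavy_small] excludes a
    residue without a sparse pair. The constant is [434 = 16 * 27 + 2]. *)
Lemma card_small W F s : 0 < s -> 0 < #|W| -> F \subset powerset W ->
  triple_le W F 6 -> (forall A, A \in F -> #|A| <= s) ->
  #|F| <= 434 * (#|W| ^ 2 * s ^ 3).
Proof.
move=> s0 W0 FW tF sF; case: (leqP #|W| (3 * s)) => hW.
  apply: leq_trans (card_triple6 FW tF) _.
  apply: leq_trans (_ : 16 * (2 * #|W|) ^ 3 <= _).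
    by rewrite leq_mul2l /= leq_exp2r // mul2n -addnn -addn1 leq_add2l.
  apply: leq_trans (_ : 128 * (#|W| ^ 2 * (3 * s)) <= _).
    by rewrite expnMn mulnA (expnSr #|W| 2) mulnA [X in _ <= X]mulnA leq_mul2l hW orbT.
  apply: leq_trans (_ : 384 * (#|W| ^ 2 * s) <= _).
    by rewrite (mulnCA _ 3) mulnA.
  apply: leq_mul => //; rewrite leq_mul2l; apply/orP; right.
  by rewrite expnS leq_pmulr // expn_gt0 s0.
pose F2 := [set A in F | 1 < #|A|].
have F2F : F2 \subset F by apply/subsetP=> A; rewrite inE => /andP[].
pose inc (p : V * V) A := [&& p.1 != p.2, p.1 \in A & p.2 \in A].
have h2 : #|F2| <= #|setX W W| * (16 * (2 * s).+1 ^ 3).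
  apply: (@card_degenerate _ _ inc) => G GF2 /set0Pn[B BG].
  have GF := subset_trans GF2 F2F.
  case: (boolP [exists p, exists C, [&& p \in setX W W, C \in G, inc p C &
       #|[set D in G | inc p D]| <= 16 * (2 * s).+1 ^ 3]]).
    by case/existsP=> p /existsP[C /and4P h]; exists p, C.
  move=> /existsPn no; exfalso.
  have B1 : #|B| <= 1.
    apply: (@heavy_small _ W G s (subset_trans GF FW) (triple_sub GF (subxx W) tF) _ hW) => //.
      by move=> A /(subsetP GF) /sF.
    move=> C x y CG xC yC xy; rewrite ltnNge; apply/negP => le.
    have := no (x, y); move/existsPn => /(_ C) /negP[].
    have /subsetP CW : C \subset W by rewrite -powersetE (subsetP FW) // (subsetP GF).
    rewrite CG /inc inE /= !CW // xy xC yC /=; apply: leq_trans le.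
    by apply: eq_leq; apply: eq_card => D; rewrite !inE.
  by move: (subsetP GF2 _ BG); rewrite inE ltnNge B1 andbF.
have hF : #|F| <= #|F2| + #|[set A in F | #|A| <= 1]|.
  apply: leq_trans (leq_card_setU _ _); apply: subset_leq_card.
  by apply/subsetP=> A AF; rewrite !inE AF /=; case: (leqP #|A| 1).
apply: leq_trans hF _; apply: leq_trans (leq_add h2 (card_le1 FW)) _.
rewrite cardsX; have hs : (2 * s).+1 ^ 3 <= 27 * s ^ 3.
  by rewrite -[27]/(3 ^ 3) -expnMn leq_exp2r // -addn1 (mulnDl 2 1) leq_add2l mul1n.
have e1 : 434 * (#|W| ^ 2 * s ^ 3) = #|W| * #|W| * (16 * (27 * s ^ 3)) + 2 * (#|W| ^ 2 * s ^ 3).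
  by rewrite -mulnn; move: (s ^ 3) #|W| => a b; clear; lia.
rewrite e1; apply: leq_add; first by rewrite leq_mul2l leq_mul2l hs !orbT.
have hs3 : 0 < s ^ 3 by rewrite expn_gt0 s0.
by move: W0 hs3; move: (s ^ 3) #|W| => a b; clear; nia.
Qed.

Lemma atoms3_compl W A B C : atoms3 W (W :\: A) (W :\: B) (W :\: C) = atoms3 W A B C.
Proof.
have h a b c : cell W (W :\: A) (W :\: B) (W :\: C) a b c = cell W A B C (~~ a) (~~ b) (~~ c).
  apply/cellP/cellP => -[x xW [h1 h2 h3]]; exists x => //; move: h1 h2 h3;
    rewrite !inE xW !andbT => h1 h2 h3; rewrite ?h1 ?h2 ?h3 ?negbK //.
  by rewrite -h1 -h2 -h3 !negbK.
rewrite !atoms3E !h /=.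
move: (cell W A B C true true true) (cell W A B C true true false)
        (cell W A B C true false true) (cell W A B C true false false)
        (cell W A B C false true true) (cell W A B C false true false)
        (cell W A B C false false true) (cell W A B C false false false).
by do 8 case.
Qed.

Lemma card_large W F s : 0 < s -> 0 < #|W| -> F \subset powerset W ->
  triple_le W F 6 -> (forall A, A \in F -> #|W :\: A| <= s) ->
  #|F| <= 434 * (#|W| ^ 2 * s ^ 3).
Proof.
move=> s0 W0 FW tF sF; rewrite -(@card_in_imset _ _ (fun A => W :\: A)); last first.
  move=> A B /(subsetP FW) + /(subsetP FW) +; rewrite !powersetE => AW BW e.
  have k D : D \subset W -> W :\: (W :\: D) = D.
    by move=> DW; rewrite setDDr setDv set0U (setIidPr DW).
  by rewrite -(k A) // e k.
apply: card_small => //.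
- by apply/subsetP=> _ /imsetP[A _ ->]; rewrite powersetE subsetDl.
- move=> _ _ _ /imsetP[A AF ->] /imsetP[B BF ->] /imsetP[C CF ->].
  by rewrite atoms3_compl tF.
- by move=> _ /imsetP[A AF ->]; apply: sF.
Qed.

Lemma split_cost p q N : 0 < p -> 0 < q -> p + q <= N ->
  384 * p.+1 ^ 2 + 384 * q.+1 ^ 2 + (16 * p.+1) * (16 * q.+1) <= 1536 * N ^ 2.
Proof.
move=> p0 q0 pq; apply: leq_trans (_ : 1536 * (p + q) ^ 2 <= _); last by rewrite leq_mul2l leq_exp2r.
by move: p0 q0; clear; rewrite -!mulnn; nia.
Qed.

(** The term [c * (N ^ 2 * (m - s))] is a potential: since [(p - s) + (q - s) + s = m - s], a split
    releases [c * (N ^ 2 * s)], exactly [s] times the cost of the split. *)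
Lemma balanced_arith c d s p q N x y z m :
  s <= p -> s <= q -> p + q = m -> z <= x + y + c * N ^ 2 ->
  s * x <= d * (s ^ 4 * p ^ 2) + c * (N ^ 2 * (p - s)) ->
  s * y <= d * (s ^ 4 * q ^ 2) + c * (N ^ 2 * (q - s)) ->
  s * z <= d * (s ^ 4 * m ^ 2) + c * (N ^ 2 * (m - s)).
Proof.
move=> sp sq <- hz hx hy.
have hz' : s * z <= s * x + s * y + c * (N ^ 2 * s).
  apply: leq_trans (_ : s * (x + y + c * N ^ 2) <= _).
    by rewrite leq_mul2l hz orbT.
  by rewrite (mulnDr s (x + y)) (mulnDr s x y) (mulnCA s c) (mulnC s (N ^ 2)).
apply: leq_trans hz' _.
apply: leq_trans (leq_add (leq_add hx hy) (leqnn _)) _.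
have e1 : d * (s ^ 4 * p ^ 2) + d * (s ^ 4 * q ^ 2) <= d * (s ^ 4 * (p + q) ^ 2).
  by rewrite -mulnDr leq_mul2l -mulnDr leq_mul2l sqrnD leq_addr !orbT.
have e2 : (p - s) + (q - s) + s = p + q - s by move: sp sq; clear; lia.
rewrite -e2 (mulnDr (N ^ 2)) (mulnDr (N ^ 2)) (mulnDr c) (mulnDr c); move: e1.
move: (d * (s ^ 4 * p ^ 2)) (d * (s ^ 4 * q ^ 2)) (d * (s ^ 4 * (p + q) ^ 2))
  (c * (N ^ 2 * (p - s))) (c * (N ^ 2 * (q - s))) (c * (N ^ 2 * s)).
by clear; move=> *; lia.
Qed.

(** Induction along members with at least [s] points on either side. Without such a member, every
    member or its complement has at most [s] points, whence [868 = 2 * 434]. The factor [s] on the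
    left avoids a division. *)
Lemma card_six_split W F s N : 0 < s -> 0 < #|W| -> #|W| <= N ->
  F \subset powerset W -> triple_le W F 6 ->
  s * #|F| <= 868 * (s ^ 4 * #|W| ^ 2) + 1536 * (N ^ 2 * (#|W| - s)).
Proof.
move=> s0; move: {2}#|W|.+1 (ltnSn #|W|) => m; elim: m W F => // m IHm W F Wm W0 WN FW tF.
case: (boolP [exists C in F, (s <= #|C|) && (s <= #|W :\: C|)]).
  case/exists_inP=> C CF /andP[sC sN].
  have CW : C \subset W by rewrite -powersetE (subsetP FW).
  have cW : #|C| + #|W :\: C| = #|W| by rewrite -[RHS](cardsID C) (setIidPr CW).
  have C0 : 0 < #|C| := leq_trans s0 sC.
  have N0 : 0 < #|W :\: C| := leq_trans s0 sN.
  apply: (balanced_arith (x := #|trace C F|) (y := #|trace (W :\: C) F|) sC sN cW).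
  - have C1 : C != set0 by rewrite -card_gt0.
    have N1 : W :\: C != set0 by rewrite -card_gt0.
    apply: leq_trans (card_split FW tF CF C1 N1) _; rewrite leq_add2l.
    by apply: split_cost; rewrite ?cW.
  - apply: IHm (sub_trace _ _) (triple_trace CW tF) => //.
      by move: Wm N0; rewrite -cW; clear; lia.
    by apply: leq_trans WN; apply: subset_leq_card.
  - apply: IHm (sub_trace _ _) (triple_trace (subsetDl _ _) tF) => //.
      by move: Wm C0; rewrite -cW; clear; lia.
    by apply: leq_trans WN; apply: subset_leq_card; apply: subsetDl.
move=> /exists_inPn nb; apply: leq_trans (leq_addr _ _).
pose F1 := [set A in F | #|A| <= s]; pose F2 := [set A in F | #|W :\: A| <= s].
have sF1 : F1 \subset F by apply/subsetP=> A; rewrite inE => /andP[].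
have sF2 : F2 \subset F by apply/subsetP=> A; rewrite inE => /andP[].
have h1 : #|F1| <= 434 * (#|W| ^ 2 * s ^ 3).
  apply: card_small => //; [exact: subset_trans FW|exact: triple_sub tF|].
  by move=> A; rewrite inE => /andP[].
have h2 : #|F2| <= 434 * (#|W| ^ 2 * s ^ 3).
  apply: card_large => //; [exact: subset_trans FW|exact: triple_sub tF|].
  by move=> A; rewrite inE => /andP[].
have hF : #|F| <= #|F1| + #|F2|.
  apply: leq_trans (leq_card_setU _ _); apply: subset_leq_card.
  apply/subsetP=> A AF; rewrite !inE AF /=; have := nb A AF.
  by rewrite negb_and -!ltnNge => /orP[] /ltnW ->; rewrite ?orbT.
apply: leq_trans (_ : s * (434 * (#|W| ^ 2 * s ^ 3) + 434 * (#|W| ^ 2 * s ^ 3)) <= _).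
  by rewrite leq_mul2l (leq_trans hF) ?orbT // leq_add.
by rewrite -mulnDl [s ^ 4]expnS; move: (s ^ 3) (#|W| ^ 2) => a b; clear; nia.
Qed.

(** For [s] of order [N ^ (1/4)] both terms of [card_six_split] become [N ^ 2 * #|W|]. Linearity in
    [#|W|] is kept so that bounds on disjoint parts can be summed; the successor covers empty
    [W]. *)
Lemma card_family6 W F s N : 0 < s -> s ^ 4 <= 16 * N -> #|W| <= N ->
  F \subset powerset W -> triple_le W F 6 ->
  s * #|F| <= 15424 * (N ^ 2 * #|W|.+1).
Proof.
move=> s0 sN WN FW tF.
have ss : s <= s ^ 4 by rewrite -{1}[s]expn1 leq_pexp2l.
have N0 : 0 < N by case: N sN {WN} => //; rewrite muln0 leqn0 expn_eq0 andbT => /eqP s00; rewrite s00 in s0.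
case: (posnP #|W|) => [W0|W0].
  have hF : #|F| <= 1.
    by apply: leq_trans (subset_leq_card FW) _; rewrite card_powerset W0.
  apply: leq_trans (_ : s * 1 <= _); first by rewrite leq_mul2l hF orbT.
  rewrite W0 !muln1; apply: leq_trans ss _; apply: leq_trans sN _.
  by apply: leq_mul => //; rewrite -{1}[N]expn1 leq_pexp2l.
apply: leq_trans (card_six_split s0 W0 WN FW tF) _.
have h1 : s ^ 4 * #|W| ^ 2 <= 16 * (N ^ 2 * #|W|).
  apply: leq_trans (leq_mul sN (leqnn _)) _; rewrite -mulnA leq_mul2l /= -!mulnn !mulnA.
  by rewrite leq_mul2r leq_mul2l WN !orbT.
have h2 : N ^ 2 * (#|W| - s) <= N ^ 2 * #|W| by rewrite leq_mul2l leq_subr orbT.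
apply: leq_trans (_ : 15424 * (N ^ 2 * #|W|) <= _); last by rewrite !leq_mul2l leqnSn !orbT.
have -> : 15424 = 868 * 16 + 1536 by [].
by rewrite mulnDl -mulnA; apply: leq_add; rewrite leq_mul2l ?h1 ?h2 orbT.
Qed.

Lemma card_family7 W F s N : 0 < s -> s ^ 4 <= 16 * N -> #|W| <= N ->
  F \subset powerset W -> triple_le W F 7 ->
  s * #|F| <= 15424 * (N ^ 3 * #|W|.+1).
Proof.
move=> s0 sN.
have ss : s <= s ^ 4 by rewrite -{1}[s]expn1 leq_pexp2l.
have N0 : 0 < N by case: N sN => //; rewrite muln0 leqn0 expn_eq0 andbT => /eqP s00; rewrite s00 in s0.
move: {2}#|W| (erefl #|W|) => m; elim: m W F => [|m IHm] W F cW WN FW tF.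
  have hF : #|F| <= 1.
    by apply: leq_trans (subset_leq_card FW) _; rewrite card_powerset cW.
  apply: leq_trans (_ : s * 1 <= _); first by rewrite leq_mul2l hF orbT.
  rewrite cW !muln1; apply: leq_trans ss _; apply: leq_trans sN _.
  by apply: leq_mul => //; rewrite -{1}[N]expn1 leq_pexp2l.
have [x xW] : exists x, x \in W by apply/set0Pn; rewrite -card_gt0 cW.
have cWx : #|W :\ x| = m by have := cardsD1 x W; rewrite xW cW add1n => -[].
have mN : #|W :\ x| <= N by rewrite cWx (leq_trans (leqnSn m)) // -cW.
have h1 := IHm _ _ cWx mN (sub_drop_pt x FW) (triple_drop_pt tF).
have h2 := card_family6 s0 sN mN (sub_link x FW) (triple_link tF isT xW).
rewrite (card_drop_link x F) cW mulnDr; apply: leq_trans (leq_add h1 h2) _.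
rewrite cWx -mulnDr leq_mul2l /= (mulnS _ m.+1) addnC leq_add2r.
by rewrite (expnSr N 2) leq_mul2l; apply/orP; right; rewrite -cW.
Qed.

(** The least [s] with [n <= s ^ 4] works: [s.-1 ^ 4 < n], and [s <= 2 * s.-1] unless [s = 1], which
    gives the factor [2 ^ 4]. *)
Lemma fourth_root n : 0 < n -> exists s, [/\ 0 < s, n <= s ^ 4 & s ^ 4 <= 16 * n].
Proof.
move=> n0; have ex : exists s, n <= s ^ 4 by exists n; rewrite -{1}[n]expn1 leq_pexp2l.
case: (ex_minnP ex) => s ns smin; exists s.
have s0 : 0 < s by case: s ns {smin} => //; rewrite exp0n // leqNgt n0.
split=> //; case: (s =P 1) => [->|s1]; first by rewrite exp1n muln_gt0.
have lt : s.-1 ^ 4 < n.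
  by rewrite ltnNge; apply/negP => /smin; move: s0; clear; lia.
apply: leq_trans (_ : (2 * s.-1) ^ 4 <= _).
  by rewrite leq_exp2r //; move: s0 s1; clear; lia.
by rewrite expnMn leq_mul2l ltnW.
Qed.

End FamilyBounds.

(** * Atoms generated by a family of cuts *)

Section Signatures.
Local Open Scope nat_scope.
Variable V : finType.
Implicit Types (A B C : {set V}) (S T : {set {set V}}).

Definition signature S x := [set A in S | x \in A].
Definition atoms S := #|signature S @: [set: V]|.

Lemma atoms0 : 0 < #|V| -> atoms set0 = 1.
Proof.
move=> V0; rewrite /atoms; have [x _] : exists x : V, x \in V by apply/card_gt0P.
rewrite (_ : _ @: _ = [set set0]) ?cards1 //; apply/setP=> B; rewrite inE.
have s0 y : signature set0 y = set0 by apply/setP=> A; rewrite !inE.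
by apply/imsetP/eqP => [[y _ ->]|->]; [apply: s0|exists x; rewrite ?s0].
Qed.

(** The atoms are numbered, and [minn] merges all those beyond the last class into it. *)
Lemma merge_atoms S k : k.+1 <= atoms S -> exists f : V -> 'I_k.+1,
  (forall x y, signature S x = signature S y -> f x = f y) /\
  (forall i, exists x, f x = i).
Proof.
rewrite /atoms; set L := signature S @: _ => kL.
exists (fun x => inord (minn (index (signature S x) (enum L)) k)); split=> [x y ->//|i].
have iL : i < size (enum L) by rewrite -cardE; apply: leq_trans kL.
have : nth set0 (enum L) i \in L by rewrite -mem_enum mem_nth.
case/imsetP=> x _ e; exists x; apply: val_inj; rewrite /= inordK ?ltnS ?geq_minr //.
rewrite -e index_uniq ?enum_uniq //; apply/minn_idPl.
by rewrite -ltnS.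
Qed.

Lemma kcut_of_onto k (f : V -> 'I_k) : (forall i, exists x, f x = i) ->
  is_kcut k (preim_partition f [set: V]).
Proof.
move=> onto; rewrite /is_kcut preim_partitionP /=.
rewrite (_ : preim_partition f _ = [set f @^-1: [set i] | i in 'I_k]).
  rewrite card_imset ?card_ord // => i j e; have [x fx] := onto i.
  by move/setP: e => /(_ x); rewrite !inE fx eqxx => /esym/eqP.
apply/setP=> B; apply/imsetP/imsetP => [[x _ ->]|[i _ ->]].
  by exists (f x) => //; apply/setP=> y; rewrite !inE eq_sym.
by have [x <-] := onto i; exists x => //; apply/setP=> y; rewrite !inE eq_sym.
Qed.

Lemma pblock_preim (D : eqType) (f : V -> D) x y :
  f x = f y -> pblock (preim_partition f [set: V]) x = pblock (preim_partition f [set: V]) y.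
Proof.
move=> e; have pP := preim_partitionP f [set: V].
apply/eqP; rewrite eq_pblock ?(partition_trivIset pP) ?(cover_partition pP) ?inE //.
rewrite pblock_equivalence_partition ?inE ?e //.
by move=> a b c _ _ _; split=> // /eqP ->.
Qed.

(* The signature with respect to S :|: [set A; B; C] determines both the label
   and the pattern. *)
Lemma sum_atoms3_le S A B C :
  \sum_(l in signature S @: [set: V]) atoms3 (signature S @^-1: [set l]) A B C
  <= atoms (S :|: [set A; B; C]).
Proof.
set L := signature S @: _; pose T := S :|: [set A; B; C].
pose h (l : {set {set V}}) := (l :&: S, (A \in l, B \in l, C \in l)).
have hT x : h (signature T x) = (signature S x, pat3 A B C x).
  rewrite /h /pat3 !inE !eqxx ?orbT /=; congr (_, _).
  by apply/setP=> D; rewrite !inE; case: (D \in S); rewrite ?andbT ?andbF.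
apply: leq_trans (leq_imset_card h _); rewrite -sum1_card.
rewrite (partition_big (fun p => p.1) (mem L)) /=; last first.
  move=> _ /imsetP[_ /imsetP[x _ ->] ->]; rewrite hT /=; exact: imset_f.
apply: leq_sum => l lL; rewrite sum1_card /atoms3.
rewrite -(@card_imset _ _ (fun p => (l, p))); last by move=> p q [].
apply: subset_leq_card; apply/subsetP=> _ /imsetP[_ /imsetP[x + ->] ->].
rewrite 2!inE => /eqP sx; rewrite unfold_in /= eqxx andbT -sx -hT.
by do 2!apply: imset_f.
Qed.

End Signatures.

(** * The greedy choice of cheap cuts *)

Section Greedy.
Local Open Scope ring_scope.
Variables (R : realType) (V : finType) (G : wgraph R V).
Implicit Types (A B C : {set V}) (S T F : {set {set V}}).

Lemma boundary_sep e A x y : e \in edges G -> x \in e -> y \in e ->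
  x \in A -> y \notin A -> e \in boundary G A.
Proof.
move=> eG xe ye xA yA; rewrite inE eG /=.
have /eqP/cards2P[a [b [ab eab]]] := edges_card2 eG.
apply/cards1P; exists x; apply/setP=> z; rewrite !inE.
apply/andP/eqP => [[ze zA]|->//].
have zy : z != y by apply: contraNneq yA => <-.
have xy : x != y by apply: contraNneq yA => <-.
move: xe ye ze xy zy; rewrite eab !inE.
by do 3![case/orP=> /eqP->]; rewrite ?eqxx.
Qed.

Lemma weight_cut_ge0 A : 0 <= total_weight G (boundary G A).
Proof. by apply: sumr_ge0 => e; rewrite inE => /andP[eG _]; apply: weight_ge0. Qed.

(** Merging atoms gives a k-cut. The ends of an edge crossing it have different signatures, so some
    cut of [S] has that edge in its boundary and pays for it. *)
Lemma opt_le_cuts S k OPT : is_opt G k.+1 OPT -> (k.+1 <= atoms S)%N ->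
  OPT <= \sum_(A in S) total_weight G (boundary G A).
Proof.
move=> [P [_ minP] ->] /merge_atoms[f [fS onto]].
apply: le_trans (minP _ (kcut_of_onto onto)) _.
set Q := preim_partition f _.
have sep e : e \in crossing_edges G Q -> e \in edges G /\ exists2 A, A \in S & e \in boundary G A.
  rewrite inE => /andP[eG /exists_inP[x xe /exists_inP[y ye npb]]]; split=> //.
  have : signature S x != signature S y.
    by apply: contra npb => /eqP/fS fxy; rewrite (pblock_preim fxy).
  case: (boolP (signature S x \subset signature S y)) => [sub|/subsetPn[A]].
    rewrite eqEsubset sub /= => /subsetPn[A]; rewrite !inE => /andP[AS yA].
    by rewrite AS /= => xA; exists A => //; apply: (boundary_sep eG ye xe).
  rewrite !inE => /andP[AS xA]; rewrite AS /= => yA _.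
  by exists A => //; apply: (boundary_sep eG xe ye).
have w0 e A : e \in boundary G A -> 0 <= weight G e.
  by rewrite inE => /andP[eG _]; apply: weight_ge0.
rewrite /kcut_weight /total_weight.
apply: le_trans (_ : \sum_(e in crossing_edges G Q) \sum_(A in S | e \in boundary G A) weight G e <= _).
  apply: ler_sum => e /sep[_ [A AS eA]]; rewrite (bigD1 A) ?AS //= lerDl.
  by apply: sumr_ge0 => B /andP[/andP[_ eB] _]; apply: w0 eB.
rewrite (exchange_big_dep (mem S)) /=; last by move=> e A _ /andP[].
apply: ler_sum => A AS; rewrite AS /=.
rewrite [X in _ <= X](bigID (mem (crossing_edges G Q))) /=.
rewrite (eq_bigl (fun e => (e \in boundary G A) && (e \in crossing_edges G Q))); last first.
  by move=> e; rewrite andbC.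
rewrite lerDl; apply: sumr_ge0 => e /andP[eA _]; exact: w0 eA.
Qed.

(** [S] is a largest family that is cheap per new atom. A cheap [T] adding [r] atoms would give
    either a larger such family or a family with [k] atoms priced below the optimum. *)
Lemma atoms_setU_cost F k OPT M t delta :
  is_opt G k OPT -> 0 < OPT -> M = OPT / k%:R -> (0 < k)%N ->
  (forall A, A \in F -> wbar G M A <= t) -> 0 <= t -> t <= 5 ->
  0 < delta -> delta <= 1 -> 14 <= delta * k%:R ->
  exists2 S, (atoms S < k)%N & forall T r, T \subset F -> (#|T| <= 3)%N -> (0 < r)%N ->
    #|T|%:R * t <= (2 - delta) * r%:R -> (atoms (S :|: T) < atoms S + r)%N.
Proof.
move=> opt OPT0 eM k0 Ft t0 t5 d0 d1 dk.
have k0R : 0 < k%:R :> R by rewrite ltr0n.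
have M0 : 0 < M / 2 by rewrite eM !divr_gt0.
have V0 : (0 < #|V|)%N.
  case: opt => P [/andP[pP /eqP cP] _] _; rewrite -cP card_gt0 in k0.
  case/set0Pn: k0 => B BP; rewrite -cardsT -(cover_partition pP).
  rewrite card_gt0; apply: contraTneq BP => c0.
  case/and3P: pP => _ _; apply: contra => BP.
  suff -> : set0 = B by [].
  by apply/esym/eqP; rewrite -subset0 -c0; apply: bigcup_sup BP.
pose cost S := \sum_(A in S) wbar G M A.
have wb0 A : 0 <= wbar G M A by rewrite divr_ge0 ?weight_cut_ge0 // ltW.
have costU S T : cost (S :|: T) <= cost S + cost T.
  rewrite /cost (bigID (mem S)) /= [X in X + _ <= _](eq_bigl (mem S)); last first.
    by move=> A /=; rewrite in_setU; case: (A \in S); case: (A \in T).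
  rewrite lerD2l [X in _ <= X](bigID (mem S)) /= addrC.
  rewrite [X in X <= _](eq_bigl (fun A => (A \in T) && (A \notin S))); last first.
    by move=> A /=; rewrite in_setU; case: (A \in S); case: (A \in T).
  by rewrite lerDl sumr_ge0.
have costF T : T \subset F -> cost T <= #|T|%:R * t.
  move=> /subsetP TF; rewrite -sum1_card natr_sum mulr_suml.
  by apply: ler_sum => A /TF/Ft; rewrite mul1r.
(* In units of [M / 2] the optimum is [2 * k]. *)
have opt_cost S : (k <= atoms S)%N -> 2 * k%:R <= cost S.
  case: (k) (k0) (opt) (eM) (k0R) => // k' _ opt' eM' k0R' kS; have := opt_le_cuts opt' kS.
  rewrite /cost /wbar -mulr_suml ler_pdivlMr // => h; apply: le_trans h.
  rewrite eM' le_eqVlt; apply/orP; left; apply/eqP; field.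
  by rewrite nat1r pnatr_eq0.
(* The [- 1] accounts for the single atom of the empty family, which costs nothing. *)
pose ok S := [&& S \subset F, (atoms S < k)%N & cost S <= (2 - delta) * ((atoms S)%:R - 1)].
have k1 : (1 < k)%N.
  by rewrite -(ltr_nat R); have := ler_wpM2r (ltW k0R) d1; lra.
have ok0 : ok set0.
  by rewrite /ok sub0set atoms0 // k1 /cost big_set0 subrr mulr0 lexx.
case: (@arg_maxnP _ set0 ok (fun S => #|S|) ok0) => S /and3P[SF Sk cS] maxS.
exists S => // T r TF T3 r0 cT; rewrite ltnNge; apply/negP => le.
have d2 : 0 <= 2 - delta by lra.
have c1 : cost (S :|: T) <= (2 - delta) * ((atoms S)%:R - 1) + #|T|%:R * t.
  by apply: le_trans (costU _ _) _; apply: lerD => //; apply: costF.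
case: (ltnP (atoms (S :|: T)) k) => hk.
  have : ok (S :|: T).
    rewrite /ok subUset SF TF hk /=; apply: le_trans c1 _.
    apply: le_trans (lerD (lexx _) cT) _; rewrite -mulrDr ler_wpM2l //.
    by move: le; rewrite -(ler_nat R) natrD; lra.
  move=> /maxS; rewrite /geq /= => cST.
  have eST : S = S :|: T by apply/eqP; rewrite eqEcard subsetUl.
  by move: le; rewrite -eST -{2}[atoms S]addn0 leq_add2l leqNgt r0.
(* The price is at most [(2 - delta) * (k - 2)] for [S] plus [3 * 5] for [T]. This is below [2 * k],
   as [delta * k >= 14] exceeds [15 - 4 + 2 * delta]. *)
have := opt_cost _ hk => c2.
have T3R : #|T|%:R <= 3 :> R by rewrite (ler_nat R _ 3).
have c3 : #|T|%:R * t <= 3 * 5 by apply: ler_pM.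
have Sk' : (atoms S)%:R <= k%:R - 1 :> R.
  by move: Sk; rewrite -(ler_nat R) -natr1; lra.
have c4 : (2 - delta) * ((atoms S)%:R - 1) <= (2 - delta) * (k%:R - 2).
  by rewrite ler_wpM2l //; lra.
have c5 : (2 - delta) * (k%:R - 2) = 2 * k%:R - delta * k%:R - 4 + 2 * delta by ring.
by move: dk d1 c1 c2 c3 c4; rewrite c5; lra.
Qed.

(** The label of a vertex is its signature for the greedy family. The price counts distinct cuts, so
    repetitions among [A], [B], [C] give the cases of one and two cuts. *)
Lemma exists_labels F k OPT M t delta :
  is_opt G k OPT -> 0 < OPT -> M = OPT / k%:R -> (0 < k)%N ->
  (forall A, A \in F -> wbar G M A <= t) -> 0 <= t -> t <= 5 ->
  0 < delta -> delta <= 1 -> 14 <= delta * k%:R ->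
  exists2 p : V -> {set {set V}}, (#|p @: [set: V]| < k)%N &
  forall A B C r, A \in F -> B \in F -> C \in F -> (0 < r)%N ->
    #|[set A; B; C]|%:R * t <= (2 - delta) * r%:R ->
    (\sum_(l in p @: [set: V]) atoms3 (p @^-1: [set l]) A B C < #|p @: [set: V]| + r)%N.
Proof.
move=> opt OPT0 eM k0 Ft t0 t5 d0 d1 dk.
have [S Sk hS] := atoms_setU_cost opt OPT0 eM k0 Ft t0 t5 d0 d1 dk.
exists (signature S) => // A B C r AF BF CF r0 cost.
apply: leq_ltn_trans (sum_atoms3_le S A B C) _; apply: hS => //.
  by rewrite !subUset !sub1set AF BF.
by rewrite -setUA cardsU1 cards2; case: (_ \notin _); case: (_ != _).
Qed.

End Greedy.

(** * Counting cuts through the parts they split *)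

Section Labels.
Local Open Scope nat_scope.
Variables (V L : finType) (p : V -> L).
Implicit Types (A B C : {set V}) (F G : {set {set V}}) (d : {set L}) (l : L).

Definition part l := p @^-1: [set l].
Definition labels := p @: [set: V].
Definition split_labels A := [set l in labels | splits A (part l)].
Definition total_atoms A B C := \sum_(l in labels) atoms3 (part l) A B C.

Lemma splits_atoms3 P A B C : splits A P -> 2 <= atoms3 P A B C.
Proof. rewrite (splits_1 P A B C) atoms3E; cell_cases P A B C. Qed.

Lemma atoms2_le_atoms3 P A B C : atoms2 P A B <= atoms3 P A B C.
Proof. rewrite !(atoms2_12 P A B C) atoms3E; cell_cases P A B C. Qed.

Lemma atoms3_gt0 l A B C : l \in labels -> 0 < atoms3 (part l) A B C.
Proof.
case/imsetP=> x _ ->; rewrite card_gt0; apply/set0Pn; exists (pat3 A B C x).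
by apply: imset_f; rewrite !inE.
Qed.

Lemma part_gt0 l : l \in labels -> 0 < #|part l|.
Proof. by case/imsetP=> x _ ->; rewrite card_gt0; apply/set0Pn; exists x; rewrite !inE. Qed.

Lemma sum_part : \sum_(l in labels) #|part l| = #|V|.
Proof.
rewrite -sum1_card (partition_big p (mem labels)) /=; last by move=> x _; apply: imset_f.
by apply: eq_bigr => l _; rewrite -sum1_card; apply: eq_bigl => x; rewrite !inE.
Qed.

(** Every other part has at least one atom, so this part holds its own atom and a surplus of at most
    [r - 1]. *)
Lemma total_atoms_one A B C r l : total_atoms A B C < #|labels| + r -> l \in labels ->
  atoms3 (part l) A B C <= r.
Proof.
move=> h lL; rewrite -ltnS -(ltn_add2l (#|labels|.-1)).
have c0 : 0 < #|labels| by apply/card_gt0P; exists l.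
rewrite -addSnnS prednK //; apply: leq_ltn_trans h.
rewrite /total_atoms (bigD1 l) //= addnC leq_add2l.
have -> : #|labels|.-1 = \sum_(i in labels | i != l) 1.
  rewrite sum1dep_card (cardsD1 l) lL /=; congr #|pred_of_set _|.
  by apply/setP=> i; rewrite !inE andbC.
by apply: leq_sum => i /andP[iL _]; apply: atoms3_gt0.
Qed.

Lemma total_atoms_two A B C r l1 l2 : total_atoms A B C < #|labels| + r ->
  l1 \in labels -> l2 \in labels -> l2 != l1 ->
  atoms3 (part l1) A B C + atoms3 (part l2) A B C <= r.+1.
Proof.
move=> h l1L l2L l12; rewrite -ltnS -(ltn_add2l (#|labels|.-2)).
have c0 : 1 < #|labels| by apply/card_gt1P; exists l2, l1.
have -> : #|labels|.-2 + r.+2 = #|labels| + r.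
  by move: c0; case: #|labels| => [|[|q]] // _; rewrite /= !addnS.
apply: leq_ltn_trans h.
rewrite /total_atoms (bigD1 l1) //= (bigD1 l2) /=; last by rewrite l2L.
rewrite [X in _ <= X]addnA [X in _ <= X]addnC leq_add2r.
have -> : #|labels|.-2 = \sum_(i in labels | (i != l1) && (i != l2)) 1.
  rewrite sum1dep_card (cardsD1 l1) l1L (cardsD1 l2) !inE l12 l2L /=.
  congr #|pred_of_set _|; apply/setP=> i; rewrite !inE.
  by case: (i == l1); case: (i == l2); rewrite ?andbT ?andbF.
rewrite (eq_bigl (fun i => (i \in labels) && (i != l1) && (i != l2))); last by move=> i; rewrite andbA.
by apply: leq_sum => i /andP[/andP[iL _] _]; apply: atoms3_gt0.
Qed.

Lemma card_split_labels A r : total_atoms A A A < #|labels| + r -> #|split_labels A| < r.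
Proof.
move=> h; rewrite -(ltn_add2l #|labels|); apply: leq_ltn_trans h.
have -> : #|split_labels A| = \sum_(l in labels) (splits A (part l) : nat).
  rewrite -sum1_card big_mkcond [RHS]big_mkcond /=; apply: eq_bigr => l _; rewrite inE.
  by case: (l \in labels); case: (splits _ _).
rewrite -sum1_card -big_split /=; apply: leq_sum => l lL.
case: (boolP (splits A (part l))) => [/splits_atoms3->//|_].
by rewrite addn0 atoms3_gt0.
Qed.

(** Outside the parts in [d] a member is a union of whole parts. The choice of these parts is the
    source of the factor [2 ^ k]. *)
Lemma card_by_trace G d : {in G, forall A, split_labels A \subset d} ->
  #|G| <= 2 ^ #|labels| * #|trace (p @^-1: d) G|.
Proof.
move=> Gd; pose full A := [set l in labels | part l \subset A].
rewrite -card_powerset -cardsX.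
rewrite -(@card_in_imset _ _ (fun A => (full A, A :&: p @^-1: d))).
  apply: subset_leq_card; apply/subsetP=> _ /imsetP[A AG ->].
  rewrite inE /= mem_trace // andbT powersetE.
  by apply/subsetP=> l; rewrite inE => /andP[].
have sub A B : A \in G -> B \in G -> full A = full B ->
    A :&: p @^-1: d = B :&: p @^-1: d -> A \subset B.
  move=> AG BG eF eT; apply/subsetP=> x xA.
  case: (boolP (p x \in d)) => [xd|xd].
    by move/setP: eT => /(_ x); rewrite !inE xd !andbT => <-.
  have pxL : p x \in labels by apply: imset_f.
  have : p x \notin split_labels A by apply: contra xd; apply/subsetP/Gd.
  rewrite inE pxL /= negb_and => /orP[h|h].
    by case/negP: h; apply/exists_inP; exists x; rewrite ?inE.
  have : p x \in full A.
    rewrite inE pxL; apply/subsetP=> y yp; apply: contraNT h => yA.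
    by apply/exists_inP; exists y.
  by rewrite eF inE => /andP[_ /subsetP]; apply; rewrite !inE.
by move=> A B AG BG [eF eT]; apply/eqP; rewrite eqEsubset !sub.
Qed.

Lemma card_cover_sum (I T : finType) (J : {set I}) (S : {set T}) (H : I -> {set T}) :
  {in S, forall x, exists2 i, i \in J & x \in H i} -> #|S| <= \sum_(i in J) #|H i|.
Proof.
move=> cov; under eq_bigr do rewrite -sum1_card big_mkcond /=.
rewrite exchange_big /= -sum1_card [X in X <= _]big_mkcond /=; apply: leq_sum => x _.
by case: ifP => // /cov[i iJ xi]; rewrite (bigD1 i) //= xi.
Qed.

(** The factor [c] will be 1 or the root [s]. Bounds linear in the size of a part add up to
    [#|V|]. *)
Lemma count_one_split G c K : 0 < #|V| -> {in G, forall A, #|split_labels A| <= 1} ->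
  {in labels, forall l, c * #|trace (part l) G| <= K * #|part l|} ->
  c * #|G| <= 2 ^ #|labels| * (K * #|V|).
Proof.
move=> /card_gt0P[x0 _] G1 hl.
pose H l := [set A in G | split_labels A \subset [set l]].
have cov : {in G, forall A, exists2 l, l \in labels & A \in H l}.
  move=> A AG; have := G1 A AG; case: (set_0Vmem (split_labels A)) => [e _|[l lA] c1].
    (* A member that splits no part is assigned to the part of the arbitrary vertex [x0]. *)
    by exists (p x0); [apply: imset_f|rewrite inE AG e sub0set].
  exists l; first by move: lA; rewrite inE => /andP[].
  by rewrite inE AG; move/card_le1_eqP: c1 => c1; apply/subsetP=> m mA; rewrite inE; apply/eqP/c1.
apply: leq_trans (leq_mul (leqnn c) (card_cover_sum cov)) _.
rewrite -sum_part !big_distrr /=; apply: leq_sum => l lL.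
apply: leq_trans (_ : c * (2 ^ #|labels| * #|trace (part l) G|) <= _).
  rewrite leq_mul2l; apply/orP; right; apply: leq_trans (@card_by_trace (H l) [set l] _) _.
    by move=> A; rewrite inE => /andP[].
  rewrite leq_mul2l; apply/orP; right; apply: subset_leq_card; apply: imsetS.
  by apply/subsetP=> A; rewrite inE => /andP[].
by rewrite mulnCA leq_mul2l hl ?orbT.
Qed.

Definition split_pair G l1 l2 := [set A in G | split_labels A == [set l1; l2]].

Lemma count_two_splits G c K : {in G, forall A, #|split_labels A| = 2} ->
  (forall l1 l2, l1 \in labels -> l2 \in labels -> l2 != l1 ->
     c * #|trace (part l1 :|: part l2) (split_pair G l1 l2)| <= K * (#|part l1| * #|part l2|)) ->
  c * #|G| <= 2 ^ #|labels| * (K * (#|V| * #|V|)).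
Proof.
move=> G2 hl; pose J := [set q in setX labels labels | q.2 != q.1].
have cov : {in G, forall A, exists2 q, q \in J & A \in split_pair G q.1 q.2}.
  move=> A AG; have /eqP/cards2P[l1 [l2 [l12 e]]] := G2 A AG.
  have /subsetP sA : split_labels A \subset labels by apply/subsetP=> l; rewrite inE => /andP[].
  exists (l1, l2); last by rewrite inE AG e /=.
  by rewrite !inE /= eq_sym l12 !sA // e !inE eqxx ?orbT.
apply: leq_trans (leq_mul (leqnn c) (card_cover_sum cov)) _.
apply: leq_trans (_ : \sum_(q in setX labels labels) 2 ^ #|labels| * (K * (#|part q.1| * #|part q.2|)) <= _).
  rewrite [X in _ <= X](bigID (mem J)) /=; apply: leq_trans (leq_addr _ _).
  rewrite (eq_bigl (fun q => (q \in setX labels labels) && (q \in J))); last first.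
    by move=> q /=; case: (boolP (q \in setX labels labels)) => // nq; rewrite in_set (negbTE nq).
  rewrite big_distrr /=; apply: leq_sum => -[l1 l2]; rewrite !inE /=.
  case/andP=> /andP[l1L l2L] /andP[_ l12].
  apply: leq_trans (_ : c * (2 ^ #|labels| * #|trace (part l1 :|: part l2) (split_pair G l1 l2)|) <= _).
    rewrite leq_mul2l /part -preimsetU; apply/orP; right; apply: card_by_trace.
    by move=> A; rewrite inE => /andP[_ /eqP ->].
  by rewrite mulnCA leq_mul2l hl ?orbT.
rewrite -!big_distrr /= leq_mul2l leq_mul2l; apply/orP; right; apply/orP; right.
rewrite -sum_part big_distrlr /= pair_big_dep /=; apply: eq_leq.
by apply: eq_bigl => -[l1 l2]; rewrite !inE.
Qed.

Lemma succ_le_double (n : nat) : 0 < n -> n.+1 <= 2 * n.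
Proof. by move=> n0; rewrite mul2n -addnn -addn1 leq_add2l. Qed.

Lemma part_le l : #|part l| <= #|V|.
Proof. exact: max_card. Qed.

Lemma part_trace_bound F r : {in F & &, forall A B C, total_atoms A B C < #|labels| + r} ->
  {in labels, forall l, triple_le (part l) (trace (part l) F) r}.
Proof.
move=> h l lL _ _ _ /imsetP[A AF ->] /imsetP[B BF ->] /imsetP[C CF ->].
rewrite (@atoms3_ext _ _ _ _ _ A B C); [|exact: in_setIP..].
by apply: total_atoms_one lL; apply: h.
Qed.

Lemma count_pairs3 F : 0 < #|V| ->
  {in F, forall A, total_atoms A A A < #|labels| + 2} ->
  {in F &, forall A B, total_atoms A B B < #|labels| + 3} ->
  #|F| <= 2 ^ #|labels| * (32 * #|V|).
Proof.
move=> V0 h1 h2; rewrite -[X in X <= _]mul1n; apply: count_one_split => //.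
  by move=> A AF; rewrite -ltnS card_split_labels // h1.
move=> l lL; rewrite mul1n; apply: leq_trans (card_triple4 (sub_trace _ _) _) _.
  apply: pairs_triple4 => _ _ /imsetP[A AF ->] /imsetP[B BF ->].
  rewrite atoms2_trace (leq_trans (atoms2_le_atoms3 _ A B B)) //.
  by apply: total_atoms_one lL; apply: h2.
apply: leq_trans (_ : 16 * (2 * #|part l|) <= _); last by rewrite mulnA.
by rewrite expn1 leq_mul2l succ_le_double ?part_gt0.
Qed.

Lemma count_triples5 F : 0 < #|V| ->
  {in F, forall A, total_atoms A A A < #|labels| + 2} ->
  {in F & &, forall A B C, total_atoms A B C < #|labels| + 5} ->
  #|F| <= 2 ^ #|labels| * (64 * #|V| * #|V|).
Proof.
move=> V0 h1 h3; rewrite -[X in X <= _]mul1n; apply: count_one_split => //.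
  by move=> A AF; rewrite -ltnS card_split_labels // h1.
move=> l lL; rewrite mul1n; apply: leq_trans (card_triple5 (sub_trace _ _) _) _.
  exact: part_trace_bound.
apply: leq_trans (_ : 16 * (2 * #|part l|) ^ 2 <= _).
  by rewrite leq_mul2l leq_exp2r // succ_le_double ?part_gt0.
apply: leq_trans (_ : 64 * #|part l| * #|part l| <= _).
  by rewrite expnMn mulnA -(mulnn #|part l|) mulnA.
by rewrite leq_mul2r leq_mul2l part_le !orbT.
Qed.

Lemma count_triples6 F s : 0 < s -> s ^ 4 <= 16 * #|V| -> 0 < #|V| ->
  {in F, forall A, total_atoms A A A < #|labels| + 2} ->
  {in F & &, forall A B C, total_atoms A B C < #|labels| + 6} ->
  s * #|F| <= 2 ^ #|labels| * (15424 * (#|V| ^ 2 * 2) * #|V|).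
Proof.
move=> s0 sV V0 h1 h3; apply: count_one_split => //.
  by move=> A AF; rewrite -ltnS card_split_labels // h1.
move=> l lL; apply: leq_trans (card_family6 s0 sV (part_le l) (sub_trace _ _) _) _.
  exact: part_trace_bound.
by rewrite -(mulnA 15424) -(mulnA (#|V| ^ 2)) !leq_mul2l succ_le_double ?part_gt0 // !orbT.
Qed.

Lemma count_triples7_one F s : 0 < s -> s ^ 4 <= 16 * #|V| -> 0 < #|V| ->
  {in F, forall A, #|split_labels A| <= 1} ->
  {in F & &, forall A B C, total_atoms A B C < #|labels| + 7} ->
  s * #|F| <= 2 ^ #|labels| * (15424 * (#|V| ^ 3 * 2) * #|V|).
Proof.
move=> s0 sV V0 h1 h3; apply: count_one_split => //.
move=> l lL; apply: leq_trans (card_family7 s0 sV (part_le l) (sub_trace _ _) _) _.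
  exact: part_trace_bound.
by rewrite -(mulnA 15424) -(mulnA (#|V| ^ 3)) !leq_mul2l succ_le_double ?part_gt0 // !orbT.
Qed.

(** From [a.+1 <= 2 * a] and [b.+1 <= 2 * b]: the product term gives [16 * 1024 = 16384], the two
    trace terms [4 * c] each. *)
Lemma two_split_arith s c N a b tp tq : 0 < s -> s <= 16 * N ^ 2 -> 0 < a -> 0 < b ->
  s * tp <= c * (N ^ 2 * (2 * a)) -> s * tq <= c * (N ^ 2 * (2 * b)) ->
  s * (2 * tp + 2 * tq + (16 * a.+1) * (16 * b.+1))
   <= (8 * c + 16384) * N ^ 2 * (a * b).
Proof.
move=> s0 sN a0 b0 hp hq.
have h1 : s * (2 * tp) <= 4 * c * N ^ 2 * (a * b).
  rewrite mulnCA; apply: leq_trans (leq_mul (leqnn 2) hp) _.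
  have -> : 2 * (c * (N ^ 2 * (2 * a))) = 4 * c * N ^ 2 * a by clear; lia.
  by rewrite mulnA leq_pmulr.
have h2 : s * (2 * tq) <= 4 * c * N ^ 2 * (a * b).
  rewrite mulnCA; apply: leq_trans (leq_mul (leqnn 2) hq) _.
  have -> : 2 * (c * (N ^ 2 * (2 * b))) = 4 * c * N ^ 2 * b by clear; lia.
  by rewrite (mulnC a) mulnA leq_pmulr.
have h3 : s * ((16 * a.+1) * (16 * b.+1)) <= 16384 * N ^ 2 * (a * b).
  have k : (16 * a.+1) * (16 * b.+1) <= 1024 * (a * b).
    have d n : 0 < n -> 16 * n.+1 <= 32 * n by clear; lia.
    by apply: leq_trans (leq_mul (d _ a0) (d _ b0)) _; rewrite mulnACA.
  apply: leq_trans (leq_mul sN k) _.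
  by rewrite mulnACA !mulnA.
rewrite (mulnDr s (2 * tp + 2 * tq)) (mulnDr s (2 * tp)).
apply: leq_trans (leq_add (leq_add h1 h2) h3) _.
have -> : 8 * c = 4 * c + 4 * c by clear; lia.
rewrite (mulnDl (4 * c + 4 * c) 16384) (mulnDl (4 * c) (4 * c)).
by rewrite (mulnDl _ (16384 * N ^ 2)) (mulnDl (4 * c * N ^ 2)).
Qed.

(** Three members generate at most 8 atoms on the two split parts together and at least 2 on each,
    so at most 6 on each. [card_family6] then bounds the traces, and [card_bipartite] combines them,
    with [cross_le] coming from pairs of cuts. *)
Lemma count_triples7_two F s : 0 < s -> s ^ 4 <= 16 * #|V| -> 0 < #|V| ->
  {in F, forall A, #|split_labels A| = 2} ->
  {in F &, forall A B, total_atoms A B B < #|labels| + 5} ->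
  {in F & &, forall A B C, total_atoms A B C < #|labels| + 7} ->
  s * #|F| <= 2 ^ #|labels| * ((8 * 15424 + 16384) * #|V| ^ 2 * (#|V| * #|V|)).
Proof.
move=> s0 sV V0 F2 h2 h3; apply: count_two_splits => // l1 l2 l1L l2L l12.
set H := split_pair F l1 l2; set P := part l1; set Q := part l2.
have HF A : A \in H -> A \in F by rewrite inE => /andP[].
have Hs l A : l \in [set l1; l2] -> A \in H -> splits A (part l).
  by move=> ll; rewrite inE => /andP[_ /eqP e]; move: ll; rewrite -e inE => /andP[].
have Hs1 A : A \in H -> splits A P by apply: Hs; rewrite !inE eqxx.
have Hs2 A : A \in H -> splits A Q by apply: Hs; rewrite !inE eqxx orbT.
pose E := trace (P :|: Q) H.
have extP A : {in P, A :&: (P :|: Q) =i A} by move=> x xP; rewrite !inE in xP *; rewrite xP andbT.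
have extQ A : {in Q, A :&: (P :|: Q) =i A} by move=> x xP; rewrite !inE in xP *; rewrite xP orbT andbT.
have sE (P' A : {set V}) : {in P', A :&: (P :|: Q) =i A} -> splits A P' -> splits (A :&: (P :|: Q)) P'.
  by move=> e; rewrite (splits_ext e).
have bip : #|E| <= 2 * #|trace P E| + 2 * #|trace Q E| + (16 * #|P|.+1) * (16 * #|Q|.+1).
  apply: card_bipartite.
  - exact: sub_trace.
  - by move=> _ /imsetP[A AH ->]; apply: sE (@extP _) (Hs1 _ AH).
  - by move=> _ /imsetP[A AH ->]; apply: sE (@extQ _) (Hs2 _ AH).
  - move=> _ _ /imsetP[A AH ->] /imsetP[B BH ->].
    rewrite (atoms2_ext (extP A) (extP B)) (atoms2_ext (extQ A) (extQ B)).
    apply: leq_trans (leq_add (atoms2_le_atoms3 P A B B) (atoms2_le_atoms3 Q A B B)) _.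
    by apply: (total_atoms_two (r := 5)) => //; apply: h2; apply: HF.
have tri A B C : A \in H -> B \in H -> C \in H -> atoms3 P A B C + atoms3 Q A B C <= 8.
  by move=> /HF AF /HF BF /HF CF; apply: (total_atoms_two (r := 7)) => //; apply: h3.
have trP : triple_le P (trace P E) 6.
  move=> _ _ _ /imsetP[_ /imsetP[A AH ->] ->] /imsetP[_ /imsetP[B BH ->] ->]
    /imsetP[_ /imsetP[C CH ->] ->].
  have -> : atoms3 P (A :&: (P :|: Q) :&: P) (B :&: (P :|: Q) :&: P)
      (C :&: (P :|: Q) :&: P) = atoms3 P A B C.
    by apply: atoms3_ext => x xP; rewrite in_setIP // extP.
  rewrite -(leq_add2r 2); apply: leq_trans (tri _ _ _ AH BH CH).
  by rewrite leq_add2l splits_atoms3 // Hs2.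
have trQ : triple_le Q (trace Q E) 6.
  move=> _ _ _ /imsetP[_ /imsetP[A AH ->] ->] /imsetP[_ /imsetP[B BH ->] ->]
    /imsetP[_ /imsetP[C CH ->] ->].
  have -> : atoms3 Q (A :&: (P :|: Q) :&: Q) (B :&: (P :|: Q) :&: Q)
      (C :&: (P :|: Q) :&: Q) = atoms3 Q A B C.
    by apply: atoms3_ext => x xP; rewrite in_setIP // extQ.
  rewrite -(leq_add2l 2); apply: leq_trans (tri _ _ _ AH BH CH).
  by rewrite leq_add2r splits_atoms3 // Hs1.
have dbl l c n : l \in labels -> c * (n * #|part l|.+1) <= c * (n * (2 * #|part l|)).
  by move=> lL; rewrite !leq_mul2l succ_le_double ?part_gt0 // !orbT.
have hP := leq_trans (card_family6 s0 sV (part_le l1) (sub_trace _ _) trP) (dbl _ _ _ l1L).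
have hQ := leq_trans (card_family6 s0 sV (part_le l2) (sub_trace _ _) trQ) (dbl _ _ _ l2L).
apply: leq_trans (leq_mul (leqnn s) bip) _.
have hs : s <= 16 * #|V| ^ 2.
  apply: leq_trans (_ : s ^ 4 <= _); first by rewrite -{1}[s]expn1 leq_pexp2l.
  by apply: leq_trans sV _; rewrite leq_mul2l -{1}[#|V|]expn1 leq_pexp2l.
exact: (@two_split_arith s 15424 #|V| _ _ _ _ s0 hs (part_gt0 l1L) (part_gt0 l2L) hP hQ).
Qed.

End Labels.

(** * Passage to real powers and constants *)

Lemma quarter_power (R : realType) (n s X Y e : nat) :
  (0 < n)%N -> (n <= s ^ 4)%N -> (s * X <= Y * n ^ e)%N ->
  X%:R <= Y%:R * n%:R `^ (e%:R - 1 / 4) :> R.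
Proof.
move=> n0 ns h; pose x := n%:R : R; have x0 : 0 < x by rewrite ltr0n.
have s0 : (0 < s)%N by case: s ns {h} => //; rewrite exp0n // leqNgt n0.
have s0R : 0 < s%:R :> R by rewrite ltr0n.
(* [r] is the real fourth root of [n]. As [r <= s], the factor [s] on the left can be traded for the
   missing quarter power on the right. *)
set r := x `^ (1 / 4).
have r0 : 0 <= r by apply: powR_ge0.
have r4 : r ^+ 4 = x.
  by rewrite -powR_mulrn // -powRrM (_ : 1 / 4 * 4%:R = 1) ?powRr1 ?ltW //; field.
have rs : r <= s%:R.
  by rewrite -(@ler_pXn2r _ 4) ?nnegrE ?ler0n // r4 -natrX ler_nat.
have xe : x ^+ e = x `^ (e%:R - 1 / 4) * r.
  rewrite -powR_mulrn ?ltW // -powRD; last by rewrite (gt_eqF x0) implybT.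
  by rewrite subrK.
rewrite -(ler_pM2l s0R); move: h; rewrite -(ler_nat R) !natrM natrX xe => h.
apply: le_trans h _; rewrite mulrA [X in _ <= X]mulrC ler_wpM2l //.
by rewrite mulr_ge0 ?powR_ge0.
Qed.

Lemma const_bound (R : realType) (K : R) (q k X c : nat) (z : R) :
  (q < k)%N -> 0 <= z -> c%:R <= K -> X%:R <= (2 ^ q * c)%:R * z ->
  X%:R <= K * (2 ^+ k * z).
Proof.
move=> qk z0 cK h; apply: le_trans h _; rewrite natrM natrX [K * _]mulrA ler_wpM2r //.
rewrite mulrC; apply: ler_pM => //; rewrite ?exprn_ge0 //.
by rewrite ler_weXn2l ?ler1n // ltnW.
Qed.

Lemma four_powers (Q c d n : nat) :
  (Q * (c * (n ^ 3 * 2) * n) + Q * (d * n ^ 2 * (n * n)) = Q * (c * 2 + d) * n ^ 4)%N.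
Proof. by rewrite !expnS expn0; lia. Qed.

(** * The four thresholds *)

Section Main.
Variables (R : realType) (gamma OPT M : R) (k n : nat) (V : finType) (G : wgraph R V).
Hypotheses (g0 : 0 < gamma) (g1 : gamma <= 1 / 10) (gk : 60 / gamma <= k%:R)
  (cV : #|V| = n) (opt : is_opt G k OPT) (OPT0 : 0 < OPT) (eM : M = OPT / k%:R).

Lemma parameters : [/\ 0 < gamma, gamma <= 1 / 10, (0 < k)%N & (0 < n)%N].
Proof.
have k0 : (0 < k)%N by rewrite -(ltr_nat R); apply: lt_le_trans gk; rewrite divr_gt0.
split; [exact: g0|exact: g1|exact: k0|]; case: opt => P [/andP[pP /eqP cP] _] _.
move: k0; rewrite -cP card_gt0 => /set0Pn[B BP]; rewrite -cV.
have [x xB] : exists x, x \in B.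
  by apply/set0Pn; case/and3P: pP => _ _; apply: contraNneq => <-.
by apply/card_gt0P; exists x.
Qed.

(** The slack [gamma / 3] fits all thresholds: [j] cuts save [j * gamma], while [r] new parts
    require only [r * gamma / 3], and [r <= 3 * j] in every use. *)
Lemma cuts_labels t : 0 <= t -> t <= 5 ->
  exists2 p : V -> {set {set V}}, (#|labels p| < k)%N &
  forall (A B C : {set V}) j r, A \in cuts_upto G M t -> B \in cuts_upto G M t ->
    C \in cuts_upto G M t -> (0 < r)%N -> (#|[set A; B; C]| <= j)%N ->
    j%:R * t <= (2 - gamma / 3) * r%:R ->
    (total_atoms p A B C < #|labels p| + r)%N.
Proof.
move=> t0 t5; have [h0 h1 k0 _] := parameters.
have d0 : 0 < gamma / 3 by rewrite divr_gt0.
have d1 : gamma / 3 <= 1 by lra.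
(* The bound [k >= 60 / gamma] even gives 20. *)
have dk : 14 <= gamma / 3 * k%:R.
  have : 60 <= gamma * k%:R by rewrite mulrC -ler_pdivrMr.
  by move=> h; rewrite mulrAC; lra.
have Ft A : A \in cuts_upto G M t -> wbar G M A <= t by rewrite inE.
have [p pk hp] := exists_labels opt OPT0 eM k0 Ft t0 t5 d0 d1 dk.
exists p => // A B C j r AF BF CF r0 cj cost; apply: hp => //.
by apply: le_trans cost; rewrite ler_wpM2r // ler_nat.
Qed.

Lemma cards_single (A : {set V}) : (#|[set A; A; A]| <= 1)%N.
Proof. by rewrite !setUid cards1. Qed.

Lemma cards_pair (A B : {set V}) : (#|[set A; B; B]| <= 2)%N.
Proof. by rewrite -setUA setUid cards2; case: (_ != _). Qed.

Lemma cards_triple (A B C : {set V}) : (#|[set A; B; C]| <= 3)%N.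
Proof. by rewrite -setUA cardsU1 cards2; case: (_ \notin _); case: (_ != _). Qed.

(** One cut costs less than two new parts, so it splits at most one part; two cuts cost
    [6 - 2 * gamma], less than three new parts. *)
Lemma card_cuts_3 : #|cuts_upto G M (3 - gamma)|%:R <= 10 ^+ 6 * (2 ^+ k * n%:R) :> R.
Proof.
have [h0 h1 k0 n0] := parameters.
have t0 : 0 <= 3 - gamma by lra.
have t5 : 3 - gamma <= 5 by lra.
have [p pk hp] := cuts_labels t0 t5.
apply: (@const_bound _ _ #|labels p| _ _ 32%N) => //; first by rewrite -natrX ler_nat.
rewrite -natrM ler_nat -cV -mulnA; apply: count_pairs3; rewrite ?cV //.
  by move=> A AF; apply: hp (cards_single A) _ => //; lra.
by move=> A B AF BF; apply: hp (cards_pair A B) _ => //; lra.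
Qed.

(** Three cuts cost [10 - 3 * gamma], less than five new parts. *)
Lemma card_cuts_10_3 : #|cuts_upto G M (10 / 3 - gamma)|%:R <= 10 ^+ 6 * (2 ^+ k * n%:R ^+ 2) :> R.
Proof.
have [h0 h1 k0 n0] := parameters.
have t0 : 0 <= 10 / 3 - gamma by lra.
have t5 : 10 / 3 - gamma <= 5 by lra.
have [p pk hp] := cuts_labels t0 t5.
apply: (@const_bound _ _ #|labels p| _ _ 64%N) => //; rewrite ?exprn_ge0 //.
  by rewrite -natrX ler_nat.
rewrite -natrX -natrM ler_nat -cV -mulnA -(mulnn #|V|) (mulnA 64); apply: count_triples5; rewrite ?cV //.
  by move=> A AF; apply: hp (cards_single A) _ => //; lra.
by move=> A B C AF BF CF; apply: hp (cards_triple A B C) _ => //; lra.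
Qed.

(** Three cuts cost [12 - 3 * gamma], less than six new parts, and one cut still costs less than
    two. *)
Lemma card_cuts_4 : #|cuts_upto G M (4 - gamma)|%:R
   <= 10 ^+ 6 * (2 ^+ k * n%:R `^ (3 - 1 / 4)) :> R.
Proof.
have [h0 h1 k0 n0] := parameters.
have t0 : 0 <= 4 - gamma by lra.
have t5 : 4 - gamma <= 5 by lra.
have [p pk hp] := cuts_labels t0 t5.
have [s [s0 ns sn]] := fourth_root n0.
have h : (s * #|cuts_upto G M (4 - gamma)| <=
    2 ^ #|labels p| * (15424 * (#|V| ^ 2 * 2) * #|V|))%N.
  apply: count_triples6; rewrite ?cV //.
    by move=> A AF; apply: hp (cards_single A) _ => //; lra.
  by move=> A B C AF BF CF; apply: hp (cards_triple A B C) _ => //; lra.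
apply: (@const_bound _ _ #|labels p| _ _ (15424 * 2)%N) => //; first exact: powR_ge0.
  by rewrite natrM; lra.
apply: (@quarter_power _ _ s _ _ 3) => //; apply: leq_trans h _; rewrite cV.
by rewrite -[X in (_ <= X)%N]mulnA (mulnC (n ^ 2)%N) (mulnA 15424%N) -(mulnA _ (n ^ 2)%N n) -expnSr.
Qed.

(** Three cuts cost less than seven new parts and two cuts less than five, but one cut is only known
    to cost less than three; so cuts splitting two parts are counted separately. *)
Lemma card_cuts_14_3 : #|cuts_upto G M (14 / 3 - gamma)|%:R
   <= 10 ^+ 6 * (2 ^+ k * n%:R `^ (4 - 1 / 4)) :> R.
Proof.
have [h0 h1 k0 n0] := parameters.
have t0 : 0 <= 14 / 3 - gamma by lra.
have t5 : 14 / 3 - gamma <= 5 by lra.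
have [p pk hp] := cuts_labels t0 t5.
have [s [s0 ns sn]] := fourth_root n0.
set F := cuts_upto G M _ in hp *.
pose F1 := [set A in F | #|split_labels p A| <= 1]%N.
pose F2 := [set A in F | #|split_labels p A| == 2]%N.
have F1F A : A \in F1 -> A \in F by rewrite inE => /andP[].
have F2F A : A \in F2 -> A \in F by rewrite inE => /andP[].
have p3 A B C : A \in F -> B \in F -> C \in F -> (total_atoms p A B C < #|labels p| + 7)%N.
  by move=> AF BF CF; apply: hp (cards_triple A B C) _ => //; lra.
have b1 : (s * #|F1| <= 2 ^ #|labels p| * (15424 * (#|V| ^ 3 * 2) * #|V|))%N.
  apply: count_triples7_one; rewrite ?cV //.
    by move=> A; rewrite inE => /andP[].
  by move=> A B C /F1F AF /F1F BF /F1F CF; apply: p3.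
have b2 : (s * #|F2| <= 2 ^ #|labels p| * ((8 * 15424 + 16384) * #|V| ^ 2 * (#|V| * #|V|)))%N.
  apply: count_triples7_two; rewrite ?cV //.
  - by move=> A; rewrite inE => /andP[_ /eqP].
  - by move=> A B /F2F AF /F2F BF; apply: hp (cards_pair A B) _ => //; lra.
  - by move=> A B C /F2F AF /F2F BF /F2F CF; apply: p3.
have hF : (#|F| <= #|F1| + #|F2|)%N.
  apply: leq_trans (leq_card_setU _ _); apply: subset_leq_card; apply/subsetP=> A AF.
  have : (#|split_labels p A| < 3)%N.
    by apply: card_split_labels; apply: hp (cards_single A) _ => //; lra.
  move=> c3; apply/setUP; case: (leqP #|split_labels p A| 1) => c1; [left|right].
    by rewrite in_set AF.
  by rewrite in_set AF /= eqn_leq c1 -ltnS c3.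
apply: (@const_bound _ _ #|labels p| _ _ (15424 * 2 + (8 * 15424 + 16384))%N) => //.
- exact: powR_ge0.
- by rewrite !natrD !natrM; lra.
apply: (@quarter_power _ _ s _ _ 4) => //.
apply: leq_trans (leq_mul (leqnn s) hF) _; rewrite mulnDr.
apply: leq_trans (leq_add b1 b2) _.
by rewrite cV four_powers.
Qed.

End Main.

Theorem theorem3p4 (R : realType) :
  exists gamma0 C K : R, [/\ 0 < gamma0, 0 < C, 0 < K &
    forall (gamma : R) (k n : nat) (V : finType) (G : wgraph R V) (OPT : R),
      0 < gamma -> gamma <= gamma0 ->
      C / gamma <= k%:R ->
      #|V| = n ->
      is_opt G k OPT ->
      (* needed for the normalization by M / 2 to make sense *)
      0 < OPT ->
      let M := OPT / k%:R in
      [/\ #|cuts_upto G M (3 - gamma)|%:R <= K * (2 ^+ k * n%:R),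
          #|cuts_upto G M (10 / 3 - gamma)|%:R <= K * (2 ^+ k * n%:R ^+ 2),
          #|cuts_upto G M (4 - gamma)|%:R
            <= K * (2 ^+ k * n%:R `^ (3 - 1 / 4)) &
          #|cuts_upto G M (14 / 3 - gamma)|%:R
            <= K * (2 ^+ k * n%:R `^ (4 - 1 / 4))]].
Proof.
(* The largest of the four constants is [15424 * 2 + (8 * 15424 + 16384) = 170624], below
   [10 ^+ 6]. *)
exists (1 / 10), 60, (10 ^+ 6); split; rewrite ?exprn_gt0 ?divr_gt0 //.
move=> gamma k n V G OPT g0 g1 gk cV opt OPT0 M; split.
- exact: card_cuts_3 (erefl M).
- exact: card_cuts_10_3 (erefl M).
- exact: card_cuts_4 (erefl M).
- exact: card_cuts_14_3 (erefl M).
Qed.
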